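(* Let $\nu>0$, $\tau>0$, let $N\ge 2$ be an integer, and let $u_0\in H^1(\mathbb T^2)\cap L^\infty(\mathbb T^2)$ have mean zero. Let $(u^n)_{n\ge 0}$ be generated by the stabilized semi-implicit Fourier-spectral scheme $$u^0=\Pi_N u_0,\qquad \frac{u^{n+1}-u^n}{\tau}=-\nu\Delta^2u^{n+1}+A\Delta(u^{n+1}-u^n)+\Delta\Pi_N\big(f(u^n)\big),\quad n\ge0,$$ with $f(u)=u^3-u$. Let $E_0=E(u_0)$. There exists a constant $\beta_c>0$ depending only on $E_0$ such that if $$A\ge \beta\cdot\big(\|u_0\|_\infty^2+\nu^{-1}|\log\nu|^2+1\big)\quad\text{for some }\beta\ge\beta_c,$$ then $E(u^{n+1})\le E(u^n)$ for all $n\ge0$ (for every $\tau>0$).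
   Context: $\mathbb T^2=\mathbb R^2/2\pi\mathbb Z^2$. For an integer $N\ge2$, $X_N=\operatorname{span}\{\cos(k\cdot x),\sin(k\cdot x): k\in\mathbb Z^2,|k|\le N\}$ and $\Pi_N:L^2(\mathbb T^2)\to X_N$ is the $L^2$-orthogonal projection (truncation of Fourier modes to $|k|\le N$). $F(u)=\frac14(u^2-1)^2$, $f=F'$, and the CH energy is $E(u)=\int_{\mathbb T^2}\big(\frac\nu2|\nabla u|^2+F(u)\big)\,dx$. The scheme determines $u^{n+1}$ uniquely via the Fourier multipliers $u^{n+1}=\frac{1-A\tau\Delta}{1+\nu\tau\Delta^2-A\tau\Delta}u^n+\frac{\tau\Delta\Pi_N}{1+\nu\tau\Delta^2-A\tau\Delta}f(u^n)$; all $u^n\in X_N$ have mean zero. *)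

(* Defs.v *)
From HB Require Import structures.
From mathcomp Require Import all_boot all_order all_algebra.
From mathcomp Require Import all_classical all_reals all_analysis.
Set Implicit Arguments. Unset Strict Implicit. Unset Printing Implicit Defensive.
Import Order.TTheory GRing.Theory Num.Theory.
Local Open Scope classical_set_scope.
Local Open Scope ring_scope.

Definition T2 (R : realType) := (measurableTypeR R * measurableTypeR R)%type.
Definition lam2 (R : realType) := ((@lebesgue_measure R) \x (@lebesgue_measure R))%E.
Definition box (R : realType) : set (T2 R) := `[0, 2 * pi]%classic `*` `[0, 2 * pi]%classic.
Definition integ2 (R : realType) (g : R * R -> R) : R := Rintegral (@lam2 R) (@box R) g.

Definition meas2 (R : realType) (u : R * R -> R) : Prop :=
  measurable_fun (@box R) (u : T2 R -> R).

Definition L2fun (R : realType) (u : R * R -> R) : Prop :=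
  meas2 u /\ (@lam2 R).-integrable (@box R) (EFin \o (fun x => u x ^+ 2)).

Definition ess_bdd (R : realType) (u : R * R -> R) (M : R) : Prop :=
  {ae (@lam2 R), forall x, @box R x -> `|u x| <= M}.

Definition Linf (R : realType) (u : R * R -> R) : Prop :=
  meas2 u /\ exists M : R, ess_bdd u M.

Definition linf_norm (R : realType) (u : R * R -> R) : R :=
  inf [set M : R | 0 <= M /\ ess_bdd u M].

Definition kdot (R : realType) (k : int * int) (x : R * R) : R :=
  k.1%:~R * x.1 + k.2%:~R * x.2.

Definition knorm2 (R : realType) (k : int * int) : R := (k.1 ^+ 2 + k.2 ^+ 2)%:~R.

(** weak gradient (g1,g2) of u on T^2, tested against the trigonometric
    functions cos(k.x), sin(k.x), k in Z^2 (periodic test functions) *)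
Definition weak_grad (R : realType) (u g1 g2 : R * R -> R) : Prop :=
  L2fun u /\ L2fun g1 /\ L2fun g2 /\
  forall k : int * int,
    [/\ integ2 (fun x => u x * (- k.1%:~R * sin (kdot k x)))
          = - integ2 (fun x => g1 x * cos (kdot k x)),
        integ2 (fun x => u x * (k.1%:~R * cos (kdot k x)))
          = - integ2 (fun x => g1 x * sin (kdot k x)),
        integ2 (fun x => u x * (- k.2%:~R * sin (kdot k x)))
          = - integ2 (fun x => g2 x * cos (kdot k x)) &
        integ2 (fun x => u x * (k.2%:~R * cos (kdot k x)))
          = - integ2 (fun x => g2 x * sin (kdot k x))].

Definition H1_with_grad (R : realType) (u g1 g2 : R * R -> R) : Prop :=
  weak_grad u g1 g2.

Definition Fpot (R : realType) (s : R) : R := (s ^+ 2 - 1) ^+ 2 / 4.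
Definition fnl (R : realType) (s : R) : R := s ^+ 3 - s.

Definition energy_with (R : realType) (nu : R) (u g1 g2 : R * R -> R) : R :=
  integ2 (fun x => nu / 2 * (g1 x ^+ 2 + g2 x ^+ 2) + Fpot (u x)).

Definition dx1 (R : realType) (u : R * R -> R) (x : R * R) : R :=
  derive1 (fun s => u (s, x.2)) x.1.
Definition dx2 (R : realType) (u : R * R -> R) (x : R * R) : R :=
  derive1 (fun t => u (x.1, t)) x.2.

(** CH energy E(u) of a smooth (e.g. trigonometric polynomial) u *)
Definition energy (R : realType) (nu : R) (u : R * R -> R) : R :=
  energy_with nu u (dx1 u) (dx2 u).

Definition modes (N : nat) : seq (int * int) :=
  [seq k <- [seq ((i%:Z - N%:Z)%R, (j%:Z - N%:Z)%R) | i <- iota 0 (2 * N + 1),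
                                                   j <- iota 0 (2 * N + 1)]
   | (k.1 ^+ 2 + k.2 ^+ 2 <= (N%:Z) ^+ 2)%R].

(** Fourier multiplier with symbol m restricted to modes |k| <= N:
    (M g)(x) = sum_{|k|<=N} m(k) ghat_k e^{i k.x}
             = (4 pi^2)^-1 sum_{|k|<=N} m(k) int_{T^2} g(y) cos(k.(x-y)) dy *)
Definition fmult (R : realType) (N : nat) (m : int * int -> R) (g : R * R -> R)
  : R * R -> R :=
  fun x => (4 * pi ^+ 2)^-1 *
    \sum_(k <- modes N) m k * integ2 (fun y => g y * cos (kdot k x - kdot k y)).

Definition PiN (R : realType) (N : nat) (g : R * R -> R) : R * R -> R :=
  fmult N (fun _ => 1) g.

Definition scheme_step (R : realType) (nu tau A : R) (N : nat) (v : R * R -> R)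
  : R * R -> R :=
  fun x =>
    fmult N (fun k => (1 + A * tau * knorm2 R k) /
                      (1 + nu * tau * knorm2 R k ^+ 2 + A * tau * knorm2 R k)) v x
  + fmult N (fun k => - (tau * knorm2 R k) /
                      (1 + nu * tau * knorm2 R k ^+ 2 + A * tau * knorm2 R k))
          (fun y => fnl (v y)) x.

(* Main.v *)
Require Import Defs.
From HB Require Import structures.
From mathcomp Require Import all_boot all_order all_algebra.
From mathcomp Require Import all_classical all_reals all_analysis.
From mathcomp Require Import measurable_realfun zify ring lra.
Set Implicit Arguments. Unset Strict Implicit. Unset Printing Implicit Defensive.
Import Order.TTheory GRing.Theory Num.Theory.
Import numFieldNormedType.Exports.
Local Open Scope classical_set_scope.
Local Open Scope ring_scope.

(** Write [d] for the increment [u^{n+1} - u^n], [D] for the Dirichlet integral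
    and [Z = A ||d||^2 + nu D(d)].  Testing the scheme with [(-Delta)^{-1} d]
    gives [E(u^{n+1}) - E(u^n) <= - Z/2 + int (2 u^2 d^2 + 3/4 d^4)], so
    everything reduces to bounding [int d^4] and [int u^2 d^2] by small
    multiples of [Z].  By Ladyzhenskaya's inequality
    [int d^4 <= C ||d||^2 D(d)], and [D(d) <= N^2 ||d||^2], one has
    [int d^4 <= C min (1/(nu A), N^2/A^2) Z^2].  If [E(u^n) <= B], Hoelder's
    inequality controls [int u^2 d^2] and testing the scheme with [d] gives
    [Z <= C B]; the step then closes as soon as
    [B min (1/(nu A), N^2/A^2)] is small.

    The disc projections are not bounded on [L^4] uniformly in [N], so the
    quartic part of [E(u^0)] needs another argument.  With [w] the part of
    [u_0] at frequencies above [N] (cut at a large [L]), duality against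
    [(u^0)^3] gives [int (u^0)^4 <= C (int u_0^4 + int w^4)], and Ladyzhenskaya
    together with Bessel gives [int w^4 <= C E_0^2 / (nu N)^2].  Hence
    [B = C(E_0) (1 + (nu N)^-2)], and the two terms of the minimum match the
    two terms of [B], so that [nu A >= C(E_0)] suffices.

    Ladyzhenskaya's inequality for trigonometric polynomials is proved on a
    fine grid, where the mean is an exact quadrature and the fundamental
    theorem of calculus becomes a telescoping sum. *)

(** * Means over the torus *)

Section mean.
Variable R : realType.
Implicit Types (f g h : R * R -> R) (k : int * int).

Notation mu := ((@lebesgue_measure R) \x (@lebesgue_measure R))%E.

Definition itg g := mu.-integrable (@box R) (EFin \o g).
Definition mean g : R := (4 * pi ^+ 2)^-1 * integ2 g.

Lemma four_pi2_gt0 : 0 < 4 * pi ^+ 2 :> R.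
Proof. by rewrite mulr_gt0 ?exprn_gt0 ?pi_gt0. Qed.

Lemma integ2E g : integ2 g = 4 * pi ^+ 2 * mean g.
Proof. by rewrite /mean mulrA divff ?mul1r// gt_eqF// four_pi2_gt0. Qed.

Lemma measurable_box : measurable (@box R).
Proof. by apply: measurableX; exact: measurable_itv. Qed.
Hint Resolve measurable_box : core.

Lemma lam2_box : mu (@box R) = (4 * pi ^+ 2)%:E.
Proof.
have itvE : lebesgue_measure (`[0, 2 * pi]%classic : set R) = (2 * pi)%:E.
  by rewrite lebesgue_measure_itv /= lte_fin mulr_gt0 ?pi_gt0// sube0.
rewrite /box product_measure1E; [|exact: measurable_itv..].
by rewrite [X in (X * _)%E]itvE [X in (_ * X)%E]itvE -EFinM; congr EFin; ring.
Qed.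

Lemma meas2_cst (c : R) : meas2 (fun=> c).
Proof. exact: measurable_cst. Qed.

Lemma itg_bounded g (M : R) : meas2 g -> (forall x, `|g x| <= M) -> itg g.
Proof.
move=> mg gM; apply: measurable_bounded_integrable => //.
  by rewrite [ltLHS]lam2_box ltry.
exists M; split; first exact: num_real.
by move=> M' MM' x _ /=; apply: le_trans (ltW MM').
Qed.

Lemma itg_cst (c : R) : itg (fun=> c).
Proof. by apply: (@itg_bounded _ `|c|) => //; exact: meas2_cst. Qed.

Lemma itgD f g : itg f -> itg g -> itg (fun x => f x + g x).
Proof. by move=> itf itg'; have := integrableD measurable_box itf itg'. Qed.

Lemma itgZ (c : R) f : itg f -> itg (fun x => c * f x).
Proof. by move=> itf; have := integrableZl measurable_box c itf. Qed.

Lemma itgM_bounded f g (M : R) : itg f -> meas2 g -> (forall x, `|g x| <= M) ->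
  itg (fun x => f x * g x).
Proof.
move=> itf mg gM.
apply: (integrableMl measurable_box itf) => //.
exists M; split; first exact: num_real.
by move=> M' MM' x _ /=; apply: le_trans (ltW MM').
Qed.

Lemma itg_le f g : meas2 f -> itg g -> (forall x, `|f x| <= g x) -> itg f.
Proof.
move=> mf itg' fg; apply: (le_integrable measurable_box _ _ itg') => //.
  by apply/measurable_EFinP.
by move=> x _ /=; rewrite lee_fin (le_trans (fg x))// ler_norm.
Qed.

Lemma meanD f g : itg f -> itg g -> mean (fun x => f x + g x) = mean f + mean g.
Proof.
by move=> itf itg'; rewrite /mean /integ2 (@RintegralD _ _ _ mu)// mulrDr.
Qed.

Lemma meanZ (c : R) f : itg f -> mean (fun x => c * f x) = c * mean f.
Proof.
by move=> itf; rewrite /mean /integ2 (@RintegralZl _ _ _ mu)// mulrCA.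
Qed.

Lemma mean_cst (c : R) : mean (fun=> c) = c.
Proof.
rewrite /mean /integ2 (@Rintegral_cst _ _ _ mu)//.
by rewrite [X in fine X]lam2_box mulrCA mulVf ?mulr1// gt_eqF// four_pi2_gt0.
Qed.

Lemma mean_le f g : itg f -> itg g -> (forall x, f x <= g x) -> mean f <= mean g.
Proof.
move=> itf itg' fg; rewrite /mean ler_wpM2l ?invr_ge0 ?(ltW four_pi2_gt0)//.
by apply: (@le_Rintegral _ _ _ mu).
Qed.

Lemma meas2_cos k (c : R) : meas2 (fun x => cos (kdot k x + c)).
Proof.
rewrite /meas2; apply: measurableT_comp.
  by apply: continuous_measurable_fun; exact: continuous_cos.
rewrite /kdot.
apply: measurable_funD; last exact: measurable_cst.
apply: measurable_funD; apply: measurable_funM; do ?exact: measurable_cst;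
 apply: measurable_funTS; [exact: measurable_fst|exact: measurable_snd].
Qed.

Lemma itg_cos k (c : R) : itg (fun x => cos (kdot k x + c)).
Proof. by apply: (@itg_bounded _ 1) => [|x]; [exact: meas2_cos|exact: cos_max]. Qed.

Lemma cosD2piz (t : R) (m : int) : cos (t + m%:~R * (2 * pi)) = cos t.
Proof.
have H (n : nat) s : cos (s + n%:R * (2 * pi)) = cos s :> R.
  rewrite -[RHS](periodicn (@cosD2pi R) n s); congr (cos (s + _)).
  by rewrite mulr_natl [2 * pi]mulr_natl.
case: m => n; first exact: H.
have -> : (Negz n)%:~R = - n.+1%:R :> R by rewrite NegzE mulrNz.
by rewrite -[LHS](H n.+1) mulNr subrK.
Qed.

Lemma sinD2piz (t : R) (m : int) : sin (t + m%:~R * (2 * pi)) = sin t.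
Proof. by rewrite -!cosBpihalf addrAC cosD2piz. Qed.

Lemma integral_cos (m : int) (c : R) : m != 0 ->
  (\int[@lebesgue_measure R]_(y in `[0%R, (2 * pi)%R]) (cos (c + m%:~R * y))%:E = 0)%E.
Proof.
move=> m0; have m0' : m%:~R != 0 :> R by rewrite intr_eq0.
pose F (y : R) := m%:~R^-1 * sin (c + m%:~R * y) : R.
have dF (y : R) : is_derive y 1 F (cos (c + m%:~R * y)).
  rewrite /F; apply: is_derive_eq.
  by rewrite /GRing.scale /= add0r mulr1 mul1r mulrCA mulVf// mulr1.
have cF : continuous F.
  by move=> y; apply: differentiable_continuous; apply/derivable1_diffP; case: (dF y).
rewrite (@continuous_FTC2 _ _ F).
- by rewrite /F mulr0 addr0 sinD2piz -EFinB subrr.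
- by rewrite mulr_gt0 ?pi_gt0.
- apply: continuous_subspaceT => y.
  apply: continuous_comp; last exact: continuous_cos.
  apply: cvgD; first exact: cvg_cst.
  by apply: cvgM; [exact: cvg_cst|exact: cvg_id].
- split=> [y _||]; first by case: (dF y).
  + by apply: cvg_at_right_filter; exact: cF.
  + by apply: cvg_at_left_filter; exact: cF.
- by move=> y _; rewrite derive1E (@derive_val _ _ _ _ _ _ _ (dF y)).
Qed.

(** Orthogonality of the characters in real form. By Fubini the inner integral is taken in a
    variable whose frequency is nonzero, where it runs over full periods and vanishes. *)
Lemma mean_cos k (c : R) :
  mean (fun x => cos (kdot k x + c)) = (k == (0, 0))%:R * cos c.
Proof.
case: k => k1 k2; case: eqP => [[-> ->]|k0].
  rewrite mul1r -[RHS]mean_cst; congr mean; apply/funext => x.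
  by rewrite /kdot /= !mul0r !add0r.
rewrite mul0r /mean /integ2 /Rintegral.
suff -> : (\int[mu]_(x in @box R) (cos (kdot (k1, k2) x + c))%:E = 0)%E by rewrite mulr0.
have itc := itg_cos (k1, k2) c.
rewrite integral_mkcond.
have /(integrable_mkcond _ measurable_box) itc' := itc.
have [k20|k20] := eqVneq k2 0; last first.
  rewrite -(integral12_prod_meas1 itc'); apply: integral0_eq => x _.
  rewrite /fubini_F.
  have [xb|xb] := boolP (x \in `[0, 2 * pi]%classic); last first.
    apply: integral0_eq => y _; rewrite patchE ifF//.
    by apply/negbTE; apply: contra xb; rewrite !inE => -[].
  rewrite -(@integral_cos k2 (k1%:~R * x + c) k20) [RHS]integral_mkcond.
  apply: eq_integral => y _; rewrite !patchE.
  have -> : ((x, y) \in @box R) = (y \in `[0, 2 * pi]%classic).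
    by apply/idP/idP; rewrite !inE; [case|rewrite inE in xb].
  by case: ifP => //= _; rewrite /kdot /=; congr (cos _)%:E; ring.
have k10 : k1 != 0 by apply/eqP => k10; apply: k0; rewrite k10 k20.
rewrite -(integral21_prod_meas1 itc'); apply: integral0_eq => y _.
rewrite /fubini_G.
have [yb|yb] := boolP (y \in `[0, 2 * pi]%classic); last first.
  apply: integral0_eq => x _; rewrite patchE ifF//.
  by apply/negbTE; apply: contra yb; rewrite !inE => -[].
rewrite -(@integral_cos k1 (k2%:~R * y + c) k10) [RHS]integral_mkcond.
apply: eq_integral => x _; rewrite !patchE.
have -> : ((x, y) \in @box R) = (x \in `[0, 2 * pi]%classic).
  by apply/idP/idP; rewrite !inE; [case|rewrite inE in yb].
by case: ifP => //= _; rewrite /kdot /=; congr (cos _)%:E; ring.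
Qed.
End mean.

(** * Trigonometric polynomials *)

Section trigonometric_polynomials.
Variable R : realType.
Implicit Types (f g h : R * R -> R) (k l : int * int) (s : seq (int * int)).

Lemma kdotD k l (x : R * R) : kdot (k + l) x = kdot k x + kdot l x.
Proof. by rewrite /kdot /= !rmorphD /=; ring. Qed.

Lemma kdotN k (x : R * R) : kdot (- k) x = - kdot k x.
Proof. by rewrite /kdot /= !rmorphN /=; ring. Qed.

(** A term is an amplitude, a phase and a frequency. The phase covers sines as well and lets
    products and translates be computed by one cosine formula; frequencies may repeat. *)
Definition trigpoly g := exists l : seq (R * R * (int * int)),
  g = fun x => \sum_(t <- l) t.1.1 * cos (kdot t.2 x + t.1.2).

Lemma tp_ind (P : (R * R -> R) -> Prop) :
  P (fun=> 0) ->
  (forall a c k f, trigpoly f -> P f -> P (fun x => a * cos (kdot k x + c) + f x)) ->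
  forall g, trigpoly g -> P g.
Proof.
move=> P0 PD g [s ->]; elim: s => [|t s IH].
  by rewrite (_ : (fun _ => _) = fun=> 0)//; apply/funext => x; rewrite big_nil.
rewrite (_ : (fun _ => _) = fun x => t.1.1 * cos (kdot t.2 x + t.1.2) +
  \sum_(t <- s) t.1.1 * cos (kdot t.2 x + t.1.2)).
  by apply: PD => //; exists s.
by apply/funext => x; rewrite big_cons.
Qed.

Lemma tp0 : trigpoly (fun=> 0).
Proof. by exists [::]; apply/funext => x; rewrite big_nil. Qed.

Lemma tpD f g : trigpoly f -> trigpoly g -> trigpoly (fun x => f x + g x).
Proof.
by move=> [s ->] [s' ->]; exists (s ++ s'); apply/funext => x; rewrite big_cat.
Qed.

Lemma tp_cos k (c : R) : trigpoly (fun x => cos (kdot k x + c)).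
Proof.
by exists [:: (1, c, k)]; apply/funext => x; rewrite big_seq1 /= mul1r.
Qed.

Lemma tpZ (a : R) f : trigpoly f -> trigpoly (fun x => a * f x).
Proof.
move=> [s ->]; exists [seq (a * t.1.1, t.1.2, t.2) | t <- s].
apply/funext => x; rewrite big_map mulr_sumr.
by apply: eq_bigr => t _ /=; rewrite mulrA.
Qed.

Lemma tp_cst (a : R) : trigpoly (fun=> a).
Proof.
have := tpZ a (tp_cos (0, 0) 0); congr trigpoly; apply/funext => x.
by rewrite /kdot /= !mul0r !add0r cos0 mulr1.
Qed.

Lemma cosMcos (a b : R) : cos a * cos b = 2^-1 * (cos (a + b) + cos (a - b)).
Proof. by rewrite cosD cosB; field. Qed.

Lemma tpM f g : trigpoly f -> trigpoly g -> trigpoly (fun x => f x * g x).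
Proof.
move=> tf tg; move: f tf; apply: tp_ind.
  by have := tp0; congr trigpoly; apply/funext => x; rewrite mul0r.
move=> a c k f tf tfg; rewrite (_ : (fun _ => _) =
    fun x => a * (cos (kdot k x + c) * g x) + f x * g x); last first.
  by apply/funext => x; rewrite mulrDl mulrA.
apply: tpD => //; apply: tpZ; move: g tg {tfg}; apply: tp_ind.
  by have := tp0; congr trigpoly; apply/funext => x; rewrite mulr0.
move=> b d l g tg tkg.
rewrite (_ : (fun _ => _) = fun x => b * (2^-1 *
    (cos (kdot (k + l) x + (c + d)) + cos (kdot (k - l) x + (c - d)))) +
    cos (kdot k x + c) * g x).
  by apply: tpD => //; do 2 apply: tpZ; apply: tpD; apply: tp_cos.
apply/funext => x; rewrite mulrDr mulrCA cosMcos !kdotD kdotN.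
by congr (_ * (_ * (cos _ + cos _)) + _); ring.
Qed.

Lemma tpX f n : trigpoly f -> trigpoly (fun x => f x ^+ n).
Proof.
move=> tf; elim: n => [|n IH]; first exact: tp_cst.
by under eq_fun do rewrite exprS; exact: tpM.
Qed.

Lemma tpN f : trigpoly f -> trigpoly (fun x => - f x).
Proof. by move=> /(tpZ (-1)); under eq_fun do rewrite mulN1r. Qed.

Lemma tp_cosk k : trigpoly (fun x => cos (kdot k x)).
Proof. by have := tp_cos k 0; under eq_fun do rewrite addr0. Qed.

Lemma tp_sink k : trigpoly (fun x => sin (kdot k x)).
Proof. by have := tp_cos k (- (pi / 2)); under eq_fun do rewrite cosBpihalf. Qed.

Lemma tp_sum (I : Type) (r : seq I) (F : I -> R * R -> R) :
  (forall i, trigpoly (F i)) -> trigpoly (fun x => \sum_(i <- r) F i x).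
Proof.
move=> tF; elim: r => [|i r IH].
  by under eq_fun do rewrite big_nil; exact: tp0.
by under eq_fun do rewrite big_cons; exact: tpD.
Qed.

Lemma tp_bounded f : trigpoly f -> meas2 f /\ exists M, forall x, `|f x| <= M.
Proof.
move: f; apply: tp_ind => [|a c k f tf [mf [M fM]]].
  by split; [exact: meas2_cst|exists 0 => x; rewrite normr0].
split.
  apply: measurable_funD => //; apply: measurable_funM; first exact: measurable_cst.
  exact: meas2_cos.
exists (`|a| + M) => x; rewrite (le_trans (ler_normD _ _))// lerD//.
by rewrite normrM ler_piMr// cos_max.
Qed.

Lemma tp_itg f : trigpoly f -> itg f.
Proof. by move=> /tp_bounded[mf [M fM]]; exact: (itg_bounded mf fM). Qed.

Lemma itgM_tp f g : trigpoly f -> itg g -> itg (fun x => f x * g x).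
Proof.
move=> /tp_bounded[mf [M fM]] itg'.
by under eq_fun do rewrite mulrC; exact: (itgM_bounded itg' mf fM).
Qed.

Lemma mean_sum (I : Type) (r : seq I) (F : I -> R * R -> R) :
  (forall i, itg (F i)) -> itg (fun x => \sum_(i <- r) F i x) /\
  mean (fun x => \sum_(i <- r) F i x) = \sum_(i <- r) mean (F i).
Proof.
move=> iF; elim: r => [|i r [ih IH]].
  by under eq_fun do rewrite big_nil; rewrite big_nil mean_cst; split=> //; exact: itg_cst.
under eq_fun do rewrite big_cons; rewrite big_cons -IH meanD//.
by split=> //; exact: itgD.
Qed.

Definition cos_coef g k := mean (fun x => g x * cos (kdot k x)).
Definition sin_coef g k := mean (fun x => g x * sin (kdot k x)).

Lemma itgc g k : itg g -> itg (fun x => g x * cos (kdot k x)).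
Proof. by move=> ig; under eq_fun do rewrite mulrC; apply: itgM_tp => //; exact: tp_cosk. Qed.

Lemma itgs g k : itg g -> itg (fun x => g x * sin (kdot k x)).
Proof. by move=> ig; under eq_fun do rewrite mulrC; apply: itgM_tp => //; exact: tp_sink. Qed.

Lemma fcD f g k : itg f -> itg g -> cos_coef (fun x => f x + g x) k = cos_coef f k + cos_coef g k.
Proof. by move=> i1 i2; rewrite /cos_coef -meanD; [under eq_fun do rewrite mulrDl| exact: itgc..]. Qed.

Lemma fsD f g k : itg f -> itg g -> sin_coef (fun x => f x + g x) k = sin_coef f k + sin_coef g k.
Proof. by move=> i1 i2; rewrite /sin_coef -meanD; [under eq_fun do rewrite mulrDl| exact: itgs..]. Qed.

Lemma fcZ (a : R) g k : itg g -> cos_coef (fun x => a * g x) k = a * cos_coef g k.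
Proof. by move=> i1; rewrite /cos_coef -meanZ; [under eq_fun do rewrite -mulrA|exact: itgc]. Qed.

Lemma fsZ (a : R) g k : itg g -> sin_coef (fun x => a * g x) k = a * sin_coef g k.
Proof. by move=> i1; rewrite /sin_coef -meanZ; [under eq_fun do rewrite -mulrA|exact: itgs]. Qed.

Lemma fcN g k : cos_coef g (- k) = cos_coef g k.
Proof. by rewrite /cos_coef; under eq_fun do rewrite kdotN cosN. Qed.

Lemma fsN g k : itg g -> sin_coef g (- k) = - sin_coef g k.
Proof.
move=> ig; rewrite /sin_coef -[RHS]mulN1r -meanZ; last exact: itgs.
by congr mean; apply/funext => x; rewrite kdotN sinN; ring.
Qed.

Lemma fs0 g : sin_coef g 0 = 0.
Proof.
rewrite -[RHS](@mean_cst R); congr mean; apply/funext => x.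
by rewrite /kdot !mul0r addr0 sin0 mulr0.
Qed.

Lemma fc_cos k l (c : R) :
  cos_coef (fun x => cos (kdot k x + c)) l = 2^-1 * ((k == - l)%:R + (k == l)%:R) * cos c.
Proof.
rewrite /cos_coef (_ : (fun _ => _) = fun x => 2^-1 *
    (cos (kdot (k + l) x + c) + cos (kdot (k - l) x + c))); last first.
  apply/funext => x; rewrite cosMcos !kdotD kdotN.
  by congr (_ * (cos _ + cos _)); ring.
rewrite meanZ; last by apply: itgD; exact: itg_cos.
rewrite meanD; [|exact: itg_cos..]; rewrite !mean_cos -mulrDl mulrA.
by rewrite -![_ == (0, 0)]/(_ == 0) subr_eq0 addr_eq0.
Qed.

Lemma fs_cos k l (c : R) :
  sin_coef (fun x => cos (kdot k x + c)) l = 2^-1 * ((k == - l)%:R - (k == l)%:R) * sin c.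
Proof.
rewrite /sin_coef (_ : (fun _ => _) = fun x => 2^-1 *
    (cos (kdot (k + l) x + (c - pi / 2)) + cos (kdot (k - l) x + (c + pi / 2)))); last first.
  apply/funext => x; rewrite -cosBpihalf cosMcos !kdotD kdotN.
  by congr (_ * (cos _ + cos _)); ring.
rewrite meanZ; last by apply: itgD; exact: itg_cos.
rewrite meanD; [|exact: itg_cos..]; rewrite !mean_cos cosBpihalf cosDpihalf.
by rewrite -![_ == (0, 0)]/(_ == 0) subr_eq0 addr_eq0; ring.
Qed.

Lemma sum_delta s k (F : int * int -> R) : uniq s ->
  \sum_(l <- s) (k == l)%:R * F l = (k \in s)%:R * F k.
Proof.
elim: s => [|l s IH] /=; first by rewrite big_nil mul0r.
move=> /andP[ls us]; rewrite big_cons IH// inE.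
have [->|_] /= := eqVneq k l; last by rewrite mul0r add0r.
by rewrite (negbTE ls) mul0r addr0.
Qed.
End trigonometric_polynomials.

(** * Fourier multipliers and derivatives *)

Section spectral.
Variable R : realType.
Implicit Types (f g h : R * R -> R) (k l : int * int) (s : seq (int * int)).

Lemma mem_modes N k : (k \in modes N) = (k.1 ^+ 2 + k.2 ^+ 2 <= N%:Z ^+ 2).
Proof.
rewrite mem_filter andb_idr// => kN.
have aux (i j : int) : i ^+ 2 + j ^+ 2 <= N%:Z ^+ 2 ->
    exists2 n : nat, n \in iota 0 (2 * N + 1) & i = n%:Z - N%:Z.
  move=> ij; have : `|i| <= N%:Z.
    rewrite -(@ler_pXn2r _ 2)// ?nnegrE// real_normK ?num_real//.
    by rewrite (le_trans _ ij)// lerDl sqr_ge0.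
  rewrite ler_norml => /andP[i1 i2]; exists (absz (i + N%:Z)).
    by rewrite mem_iota; lia.
  by lia.
have [a a1 a2] := aux _ _ kN.
have [b b1 b2] : exists2 n : nat, n \in iota 0 (2 * N + 1) & k.2 = n%:Z - N%:Z.
  by apply: aux; rewrite addrC; exact: kN.
apply/allpairsP; exists (a, b); split=> //=.
by rewrite -a2 -b2; case: (k).
Qed.

Lemma uniq_modes N : uniq (modes N).
Proof.
rewrite filter_uniq// allpairs_uniq ?iota_uniq// => -[a b] [c d] _ _ /= [].
by move=> /addIr[->] /addIr[->].
Qed.

Definition symm s := forall k, (- k \in s) = (k \in s).

Lemma symm_modes N : symm (modes N).
Proof. by move=> k; rewrite !mem_modes /= !sqrrN. Qed.

Lemma modes_le N M : (N <= M)%N -> {subset modes N <= modes M}.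
Proof.
move=> NM k; rewrite !mem_modes => /le_trans; apply.
by rewrite ler_pXn2r ?nnegrE// lez_nat.
Qed.

(** For symmetric [s] a nonzero frequency occurs as [k] and as [- k] with equal contributions. This
    supplies the factor 2 of the usual real Fourier series, so the coefficients are plain means and
    frequency zero is no special case. *)
Definition spanned s g := forall x,
  g x = \sum_(k <- s) (cos_coef g k * cos (kdot k x) + sin_coef g k * sin (kdot k x)).

Definition mult s (m : int * int -> R) g x :=
  \sum_(k <- s) m k * (cos_coef g k * cos (kdot k x) + sin_coef g k * sin (kdot k x)).

Lemma spanned_cos s k (c : R) : uniq s -> symm s -> k \in s ->
  spanned s (fun x => cos (kdot k x + c)).
Proof.
move=> us ss ks x.
under eq_bigr => l _.
  rewrite fc_cos fs_cos (_ : _ + _ = (- k == l)%:R * (2^-1 * (cos c * cos (kdot l x) + sin c * sin (kdot l x)))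
   + (k == l)%:R * (2^-1 * (cos c * cos (kdot l x) - sin c * sin (kdot l x)))); last first.
    by rewrite eqr_oppLR; ring.
over.
by rewrite big_split /= !sum_delta// ss ks !mul1r kdotN cosN sinN cosD; field.
Qed.

Lemma spannedD s f g : itg f -> itg g -> spanned s f -> spanned s g ->
  spanned s (fun x => f x + g x).
Proof.
move=> i1 i2 sf sg x; rewrite sf sg -big_split; apply: eq_bigr => k _ /=.
by rewrite fcD// fsD//; ring.
Qed.

Lemma spannedZ s (a : R) f : itg f -> spanned s f -> spanned s (fun x => a * f x).
Proof.
move=> i1 sf x; rewrite sf mulr_sumr; apply: eq_bigr => k _ /=.
by rewrite fcZ// fsZ//; ring.
Qed.

(** Stated for all large discs so that several polynomials can be expanded over a common one. *)
Lemma tp_spanned g : trigpoly g -> exists N, forall M, (N <= M)%N -> spanned (modes M) g.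
Proof.
move: g; apply: tp_ind => [|a c k f tf [N sf]].
  exists 0%N => M _ x; rewrite big1// => k _.
  by rewrite /cos_coef /sin_coef; under eq_fun do rewrite mul0r; under [X in _ + mean X * _]eq_fun do rewrite mul0r;
     rewrite mean_cst !mul0r addr0.
(* The disc of radius $|k_1|+|k_2|$ contains [k]. *)
exists (maxn N (absz k.1 + absz k.2)) => M; rewrite geq_max => /andP[NM kM].
apply: spannedD; [by apply: tp_itg; apply: tpZ; exact: tp_cos|exact: tp_itg| |exact: sf].
apply: spannedZ; first exact: itg_cos.
apply: spanned_cos; [exact: uniq_modes|exact: symm_modes|].
rewrite mem_modes.
have : (absz k.1 + absz k.2)%:Z ^+ 2 <= M%:Z ^+ 2 by rewrite ler_pXn2r ?nnegrE// lez_nat.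
apply: le_trans.
have absK (i : int) : (absz i)%:Z ^+ 2 = i ^+ 2.
  by case: i => n //; rewrite NegzE abszN sqrrN.
by rewrite PoszD sqrrD !absK addrAC lerDl mulrn_wge0// mulr_ge0.
Qed.

(** Only [f] has finite spectrum; [g] is merely integrable, so rough data and nonlinear terms can be
    tested against polynomials. *)
Lemma parseval s f g : spanned s f -> itg g ->
  mean (fun x => f x * g x) = \sum_(k <- s) (cos_coef f k * cos_coef g k + sin_coef f k * sin_coef g k).
Proof.
move=> sf ig.
have it k : itg (fun x => cos_coef f k * (g x * cos (kdot k x)) + sin_coef f k * (g x * sin (kdot k x))).
  by apply: itgD; apply: itgZ; [exact: itgc|exact: itgs].
rewrite (_ : (fun _ => _) = fun x => \sum_(k <- s)
   (cos_coef f k * (g x * cos (kdot k x)) + sin_coef f k * (g x * sin (kdot k x)))); last first.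
  by apply/funext => x; rewrite sf mulr_suml; apply: eq_bigr => k _; ring.
rewrite (mean_sum s it).2; apply: eq_bigr => k _.
by rewrite meanD ?meanZ//; [exact: itgs|exact: itgc|apply: itgZ; exact: itgc|apply: itgZ; exact: itgs].
Qed.

Lemma tp_mult s m g : trigpoly (mult s m g).
Proof.
apply: tp_sum => k; apply: tpZ; apply: tpD; apply: tpZ; [exact: tp_cosk|exact: tp_sink].
Qed.

(** By orthogonality the coefficient at [l] receives one half from the mode [l] and one half from
    [- l]. Evenness of [m] and symmetry of [s] make the halves equal. *)
Lemma coef_mult s m g l : uniq s -> symm s -> (forall k, m (- k) = m k) -> itg g ->
  cos_coef (mult s m g) l = (l \in s)%:R * (m l * cos_coef g l) /\
  sin_coef (mult s m g) l = (l \in s)%:R * (m l * sin_coef g l).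
Proof.
move=> us ss mN ig.
have E k : (fun x => cos (kdot k x)) = fun x : R * R => cos (kdot k x + 0).
  by apply/funext => x; rewrite addr0.
have E' k : (fun x => sin (kdot k x)) = fun x : R * R => cos (kdot k x + - (pi / 2)).
  by apply/funext => x; rewrite cosBpihalf.
have itk k : itg (fun x => m k * (cos_coef g k * cos (kdot k x) + sin_coef g k * sin (kdot k x))).
  apply: tp_itg; apply: tpZ; apply: tpD; apply: tpZ; [exact: tp_cosk|exact: tp_sink].
have tkc k := tp_itg (tp_cosk R k); have tks k := tp_itg (tp_sink R k).
split.
- transitivity (mean (fun x => \sum_(k <- s)
    (m k * (cos_coef g k * cos (kdot k x) + sin_coef g k * sin (kdot k x))) * cos (kdot l x))).
    by rewrite /cos_coef /sin_coef; congr mean; apply/funext => x; rewrite mulr_suml.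
  rewrite (mean_sum s (fun k => itgc l (itk k))).2.
  transitivity (\sum_(k <- s) ((- l == k)%:R * (2^-1 * (m k * cos_coef g k)) +
      (l == k)%:R * (2^-1 * (m k * cos_coef g k)))).
    apply: eq_bigr => k _; rewrite -/(cos_coef _ l) fcZ; last by apply: itgD; apply: itgZ.
    rewrite fcD; [|exact: itgZ..].
    rewrite !fcZ// E E' !fc_cos cos0 cosN cos_pihalf.
    by rewrite [k == - l]eq_sym [k == l]eq_sym; ring.
  by rewrite big_split /= !sum_delta// ss mN fcN; field.
- transitivity (mean (fun x => \sum_(k <- s)
    (m k * (cos_coef g k * cos (kdot k x) + sin_coef g k * sin (kdot k x))) * sin (kdot l x))).
    by rewrite /cos_coef /sin_coef; congr mean; apply/funext => x; rewrite mulr_suml.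
  rewrite (mean_sum s (fun k => itgs l (itk k))).2.
  transitivity (\sum_(k <- s) ((- l == k)%:R * (- 2^-1 * (m k * sin_coef g k)) +
      (l == k)%:R * (2^-1 * (m k * sin_coef g k)))).
    apply: eq_bigr => k _; rewrite -/(sin_coef _ l) fsZ; last by apply: itgD; apply: itgZ.
    rewrite fsD; [|exact: itgZ..].
    rewrite !fsZ// E E' !fs_cos sin0 sinN sin_pihalf.
    by rewrite [k == - l]eq_sym [k == l]eq_sym; ring.
  by rewrite big_split /= !sum_delta// ss mN fsN//; field.
Qed.

(** The addition formula for $\cos(k\cdot x-k\cdot y)$ turns the convolution kernel into Fourier
    coefficients. *)
Lemma fmultE N m g : itg g -> fmult N m g = mult (modes N) m g.
Proof.
move=> ig; apply/funext => x; rewrite /fmult /mult mulr_sumr; apply: eq_bigr => k _.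
rewrite mulrCA -/(mean _); congr (_ * _).
rewrite (_ : (fun _ => _) = fun y => cos (kdot k x) * (g y * cos (kdot k y)) +
    sin (kdot k x) * (g y * sin (kdot k y))); last first.
  by apply/funext => y; rewrite cosB; ring.
rewrite meanD; [|by apply: itgZ; exact: itgc|by apply: itgZ; exact: itgs].
by rewrite !meanZ; [rewrite /cos_coef /sin_coef; ring|exact: itgs|exact: itgc].
Qed.

Lemma spanned_mult s m g : uniq s -> symm s -> (forall k, m (- k) = m k) -> itg g ->
  spanned s (mult s m g).
Proof.
move=> us ss mN ig x; rewrite {1}/mult big_seq [RHS]big_seq; apply: eq_bigr => k ks.
have [-> ->] := coef_mult k us ss mN ig; rewrite ks.
by rewrite !mul1r; ring.
Qed.

(** The left-hand function is the derivative of [a * cos (kdot k x + c)] in the variable of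
    frequency [z']. Both coefficients at [l] vanish unless [l] is [k] or [- k], so [z'] has to match
    [z] up to sign only there. *)
Lemma coef_dcos (a c : R) k l (z : int) (z' : int) : 
  (k == l -> z' = z) -> (k == - l -> z' = - z) ->
  cos_coef (fun x => - (a * z'%:~R) * cos (kdot k x + (c - pi / 2))) l =
    z%:~R * sin_coef (fun x => a * cos (kdot k x + c)) l /\
  sin_coef (fun x => - (a * z'%:~R) * cos (kdot k x + (c - pi / 2))) l =
    - z%:~R * cos_coef (fun x => a * cos (kdot k x + c)) l.
Proof.
move=> e1 e2; rewrite !fcZ ?fsZ; [|exact: itg_cos..].
rewrite !fc_cos !fs_cos cosBpihalf sinBpihalf.
case: eqP e2 => [_ /(_ isT)|_ _]; case: eqP e1 => [_ /(_ isT)|_ _].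
(* If [k] equals both [l] and [- l], the two hypotheses give [z = - z], hence [z = 0]. *)
- by move=> -> /eqP; rewrite -subr_eq0 opprK -mulr2n mulrn_eq0 /= => /eqP ->; rewrite /=; split; ring.
- by move=> ->; rewrite rmorphN /=; split; ring.
- by move=> ->; rewrite /=; split; ring.
- by rewrite /=; split; ring.
Qed.

Lemma tp_dx g : trigpoly g -> exists g1 g2, [/\ trigpoly g1, trigpoly g2,
  (forall x y, is_derive x (1 : R) (fun z => g (z, y)) (g1 (x, y))),
  (forall x y, is_derive y (1 : R) (fun z => g (x, z)) (g2 (x, y))) &
  forall k, [/\ cos_coef g1 k = k.1%:~R * sin_coef g k, sin_coef g1 k = - k.1%:~R * cos_coef g k,
    cos_coef g2 k = k.2%:~R * sin_coef g k & sin_coef g2 k = - k.2%:~R * cos_coef g k]].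
Proof.
move: g; apply: tp_ind => [|a c k f tf [f1 [f2 [t1 t2 d1 d2 cf]]]].
  exists (fun=> 0), (fun=> 0); split; do ?exact: tp0; do ?by move=> *; exact: is_derive_cst.
  have z0 h : mean (fun x => (0 : R) * h x) = 0.
    by under eq_fun do rewrite mul0r; rewrite mean_cst.
  by move=> k; rewrite /cos_coef /sin_coef !z0 !mulr0.
exists (fun x => - (a * k.1%:~R) * cos (kdot k x + (c - pi / 2)) + f1 x),
       (fun x => - (a * k.2%:~R) * cos (kdot k x + (c - pi / 2)) + f2 x).
split.
- by apply: tpD => //; apply: tpZ; exact: tp_cos.
- by apply: tpD => //; apply: tpZ; exact: tp_cos.
- move=> x y; have := d1 x y; rewrite /kdot /= => d1'.
  apply: is_derive_eq; rewrite /GRing.scale /= addrA cosBpihalf; ring.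
- move=> x y; have := d2 x y; rewrite /kdot /= => d2'.
  apply: is_derive_eq; rewrite /GRing.scale /= addrA cosBpihalf; ring.
move=> l; have [e1 e2 e3 e4] := cf l.
have ic z e := tp_itg (tpZ z (tp_cos k (e : R))).
have if' := tp_itg tf; have i1 := tp_itg t1; have i2 := tp_itg t2.
have [||c1 c2] := @coef_dcos a c k l l.1 k.1; [by move=> /eqP ->|by move=> /eqP ->|].
have [||c3 c4] := @coef_dcos a c k l l.2 k.2; [by move=> /eqP ->|by move=> /eqP ->|].
by split; rewrite ?fcD ?fsD// ?c1 ?c2 ?c3 ?c4 ?e1 ?e2 ?e3 ?e4 mulrDr.
Qed.

Lemma tp_dx1 g : trigpoly g -> trigpoly (dx1 g) /\
  forall k, cos_coef (dx1 g) k = k.1%:~R * sin_coef g k /\ sin_coef (dx1 g) k = - k.1%:~R * cos_coef g k.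
Proof.
move=> /tp_dx[g1 [g2 [t1 _ d1 _ cg]]].
suff -> : dx1 g = g1 by split=> // k; have [] := cg k.
apply/funext => -[x y]; rewrite /dx1 derive1E.
by rewrite (@derive_val _ _ _ _ _ _ _ (d1 x y)).
Qed.

Lemma tp_dx2 g : trigpoly g -> trigpoly (dx2 g) /\
  forall k, cos_coef (dx2 g) k = k.2%:~R * sin_coef g k /\ sin_coef (dx2 g) k = - k.2%:~R * cos_coef g k.
Proof.
move=> /tp_dx[g1 [g2 [_ t2 _ d2 cg]]].
suff -> : dx2 g = g2 by split=> // k; have [] := cg k.
apply/funext => -[x y]; rewrite /dx2 derive1E.
by rewrite (@derive_val _ _ _ _ _ _ _ (d2 x y)).
Qed.
End spectral.

(** * Exact quadrature on a grid *)

Section grid.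
Variable R : realType.
Implicit Types (f g h : R * R -> R) (k l : int * int).

Definition avg (M : nat) g : R := M%:R ^- 2 *
  \sum_(i < M) \sum_(j < M) g (i%:R * (2 * pi / M%:R), j%:R * (2 * pi / M%:R)).

Lemma avgD M f g : avg M (fun x => f x + g x) = avg M f + avg M g.
Proof.
rewrite /avg -mulrDr -big_split; congr (_ * _); apply: eq_bigr => i _.
by rewrite -big_split.
Qed.

Lemma avgZ M (a : R) f : avg M (fun x => a * f x) = a * avg M f.
Proof.
rewrite /avg mulrCA; congr (_ * _); rewrite mulr_sumr; apply: eq_bigr => i _.
by rewrite -mulr_sumr.
Qed.

Lemma avg_le M f g : (forall x, f x <= g x) -> avg M f <= avg M g.
Proof.
move=> fg; rewrite /avg ler_wpM2l ?invr_ge0 ?exprn_ge0//.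
by apply: ler_sum => i _; apply: ler_sum.
Qed.

(** Multiplication by $2\sin(t/2)$, with $t=2\pi m/M$, makes the sum telescope, and the end points
    differ by a multiple of $2\pi$. The factor is nonzero because $0<|m|<M$ puts $t/2$ strictly
    between consecutive multiples of $\pi$ around the origin, away from 0. *)
Lemma sum_cos_grid (M : nat) (m : int) (c : R) : m != 0 -> (absz m < M)%N ->
  \sum_(i < M) cos (m%:~R * (i%:R * (2 * pi / M%:R)) + c) = 0.
Proof.
move=> m0 mM; have M0 : M%:R != 0 :> R by rewrite pnatr_eq0; lia.
pose t : R := m%:~R * (2 * pi / M%:R).
have s0 : sin (t / 2) != 0.
  have -> : t / 2 = m%:~R * (pi / M%:R) by rewrite /t; field.
  have sp (n : nat) : (0 < n < M)%N -> 0 < sin (n%:R * (pi / M%:R)) :> R.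
    move=> /andP[n0 nM]; apply: sin_gt0_pi.
    rewrite mulr_gt0 ?divr_gt0 ?pi_gt0 ?ltr0n//=; last by lia.
    rewrite mulrCA gtr_pMr ?pi_gt0// ltr_pdivrMr ?mul1r ?ltr_nat// ltr0n; lia.
  case: m m0 mM {t} => n m0 mM; first by rewrite gt_eqF// sp//; lia.
  rewrite NegzE mulrNz mulNr sinN oppr_eq0 gt_eqF//.
  by apply: sp; lia.
have {}s0 : 2 * sin (t / 2) != 0 by rewrite mulf_neq0// pnatr_eq0.
apply: (mulfI s0); rewrite mulr0 mulr_sumr.
pose F (i : nat) := sin (i%:R * t + c - t / 2).
rewrite -(big_mkord xpredT (fun i => 2 * sin (t / 2) * cos (m%:~R * (i%:R * (2 * pi / M%:R)) + c))).
rewrite (telescope_sumr_eq F)//.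
  rewrite /F mul0r (_ : M%:R * t + c - t / 2 = 0 + c - t / 2 + m%:~R * (2 * pi)).
    by rewrite sinD2piz subrr.
  by rewrite /t; field.
move=> i _; rewrite /F.
rewrite (_ : i.+1%:R * t + c - t / 2 = (i%:R * t + c) + t / 2); last first.
  by rewrite -natr1; field.
rewrite (_ : m%:~R * _ + c = i%:R * t + c); last by rewrite /t; ring.
by rewrite sinD sinB; ring.
Qed.

Lemma avg_cos M k (c : R) : (absz k.1 < M)%N -> (absz k.2 < M)%N ->
  avg M (fun x => cos (kdot k x + c)) = (k == 0)%:R * cos c.
Proof.
case: k => k1 k2 /= k1M k2M; have M0 : M%:R != 0 :> R by rewrite pnatr_eq0; lia.
rewrite /avg /kdot /=; case: eqP => [[-> ->]|k0].
  under eq_bigr do under eq_bigr do rewrite !mul0r !add0r.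
  by rewrite !sumr_const !card_ord -[_ *+ M *+ M]mulr_natl -[_ *+ M]mulr_natl mul1r; field.
rewrite mul0r; apply/eqP; rewrite mulf_eq0; apply/orP; right; apply/eqP.
have [k20|k20] := eqVneq k2 0; last first.
  rewrite big1// => i _; under eq_bigr do rewrite addrAC addrC.
  rewrite sum_cos_grid//.
have k10 : k1 != 0 by apply/eqP => k10; apply: k0; rewrite k10 k20.
rewrite exchange_big /= big1// => j _; under eq_bigr do rewrite -addrA.
by rewrite sum_cos_grid.
Qed.

Lemma kdotDr k (x y : R * R) : kdot k (x + y) = kdot k x + kdot k y.
Proof. by rewrite /kdot /=; ring. Qed.

Lemma tp_shift g (a : R * R) : trigpoly g -> trigpoly (fun x => g (x + a)).
Proof.
move: g; apply: tp_ind => [|b c k f tf IH]; first exact: tp0.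
apply: tpD => //; apply: tpZ; have := tp_cos k (c + kdot k a); congr trigpoly.
by apply/funext => x; rewrite kdotDr; congr cos; ring.
Qed.

(* The threshold on [M] is uniform in the shifts, which below depend on [M]. *)
Lemma quadrature f g : trigpoly f -> trigpoly g -> exists M0, forall M, (M0 <= M)%N -> forall a b,
  avg M (fun x => f (x + a) * g (x + b)) = mean (fun x => f (x + a) * g (x + b)).
Proof.
move=> tf tg; move: f tf; apply: tp_ind => [|al c k f tf [M1 IH]].
  exists 0%N => M _ a b; under eq_fun do rewrite mul0r; rewrite mean_cst.
  by rewrite /avg big1 ?mulr0// => i _; rewrite big1.
suff [M2 IH2] : exists M0, forall M, (M0 <= M)%N -> forall a b,
    avg M (fun x => cos (kdot k (x + a) + c) * g (x + b)) =
    mean (fun x => cos (kdot k (x + a) + c) * g (x + b)).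
  exists (maxn M1 M2) => M; rewrite geq_max => /andP[M1M M2M] a b.
  under eq_fun do rewrite mulrDl -mulrA.
  have ta := tp_shift a tf; have tb := tp_shift b tg.
  have tc := tp_shift a (tp_cos k c).
  rewrite avgD avgZ meanD ?meanZ ?IH ?IH2//.
  - by apply: tp_itg; exact: tpM.
  - by apply: itgZ; apply: tp_itg; exact: tpM.
  - by apply: tp_itg; exact: tpM.
clear IH; move: g tg; apply: tp_ind => [|be d l g tg [M2 IH2]].
  exists 0%N => M _ a b; under eq_fun do rewrite mulr0; rewrite mean_cst.
  by rewrite /avg big1 ?mulr0// => i _; rewrite big1.
(* The product has frequencies [k + l] and [k - l]; this threshold keeps all their coordinates below
   [M], so there is no aliasing. *)
exists (maxn M2 (absz k.1 + absz k.2 + absz l.1 + absz l.2).+1) => M.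
rewrite geq_max => /andP[M2M klM] a b.
have E : (fun x => cos (kdot k (x + a) + c) * (be * cos (kdot l (x + b) + d) + g (x + b)))
  = fun x => be * 2^-1 * (cos (kdot (k + l) x + (kdot k a + c + kdot l b + d)) +
     cos (kdot (k - l) x + (kdot k a + c - kdot l b - d))) +
     cos (kdot k (x + a) + c) * g (x + b).
  apply/funext => x; rewrite mulrDr mulrCA cosMcos mulrA !kdotD kdotN !kdotDr.
  by congr (_ * (cos _ + cos _) + _); ring.
have tb := tp_shift b tg; have tc := tp_shift a (tp_cos k c).
rewrite E avgD avgZ avgD IH2// !avg_cos /=; [|lia..].
rewrite meanD ?meanZ ?meanD ?mean_cos//; do ?exact: itg_cos.
- by apply: itgD; exact: itg_cos.
- by apply: itgZ; apply: itgD; exact: itg_cos.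
- by apply: tp_itg; exact: tpM.
Qed.
End grid.

(** * Cauchy-Schwarz inequalities and Fourier coefficients of translates *)

Section parseval_estimates.
Variable R : realType.
Implicit Types (f g h : R * R -> R) (k l : int * int) (s : seq (int * int)).

Lemma norm_sin_le (t : R) : `|sin t| <= `|t|.
Proof.
wlog t0 : t / 0 <= t.
  move=> H; have [/H//|/ltW t0] := leP 0 t.
  by rewrite -normrN -sinN -[leRHS]normrN H// oppr_ge0.
have [|c _] := @MVT_segment R sin cos 0 t t0.
- by apply: continuous_subspaceT; exact: continuous_sin.
- by rewrite sin0 !subr0 => ->; rewrite normrM ler_piMl// cos_max.
Qed.

(** The left side is $|e^{it}-1|^2=4\sin^2(t/2)$. *)
Lemma chord_le (t : R) : (cos t - 1) ^+ 2 + sin t ^+ 2 <= t ^+ 2.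
Proof.
have -> : t = t / 2 + t / 2 by field.
rewrite cosD sinD; set c := cos _; set s := sin _.
have cs : c ^+ 2 = 1 - s ^+ 2 by rewrite -(cos2Dsin2 (t / 2)) addrK.
have : s ^+ 2 <= (t / 2) ^+ 2.
  by rewrite -[leLHS]real_normK ?num_real// -[leRHS]real_normK ?num_real// lerXn2r ?nnegrE// norm_sin_le.
have -> : (c * c - s * s - 1) ^+ 2 + (s * c + c * s) ^+ 2 =
  (c ^+ 2 - s ^+ 2 - 1) ^+ 2 + 4 * s ^+ 2 * c ^+ 2 by ring.
by rewrite cs; nra.
Qed.

(** The discriminant criterion behind both Cauchy-Schwarz inequalities below; for [b > 0] the
    minimum is at [t = p / b]. *)
Lemma sqr_le_of_quadratic (a p b : R) : 0 <= b ->
  (forall t, 0 <= a - 2 * t * p + t ^+ 2 * b) -> p ^+ 2 <= a * b.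
Proof.
rewrite le_eqVlt => /predU1P[<-|b0] H; last first.
  have := H (p / b).
  have -> : a - 2 * (p / b) * p + (p / b) ^+ 2 * b = a - p ^+ 2 / b.
    by field; exact: lt0r_neq0.
  by rewrite subr_ge0 ler_pdivrMr.
(* With [b = 0] and [p] nonzero the quadratic is affine: $t=(a+1)/p$ gives $-a-2\ge0$, against
   $a\ge0$ from $t=0$. *)
have [->|p0] := eqVneq p 0; first by rewrite mulr0 expr0n.
have := H ((a + 1) / p); rewrite mulr0 addr0 -mulrA divfK//.
by have := H 0; rewrite !mulr0 !mul0r; lra.
Qed.

Lemma mean_sqr_ge0 f : trigpoly f -> 0 <= mean (fun x => f x ^+ 2).
Proof.
move=> tf; rewrite -[leLHS](mean_cst (0 : R)); apply: mean_le.
- exact: itg_cst.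
- by apply: tp_itg; exact: tpX.
- by move=> x; rewrite sqr_ge0.
Qed.

Lemma mean_sqrB f g : trigpoly f -> trigpoly g -> mean (fun x => (f x - g x) ^+ 2) =
  mean (fun x => f x ^+ 2) - 2 * mean (fun x => f x * g x) + mean (fun x => g x ^+ 2).
Proof.
move=> tf tg; rewrite -mulNr.
have i1 := tp_itg (tpX 2 tf); have i2 := tp_itg (tpX 2 tg); have i3 := tp_itg (tpM tf tg).
rewrite -meanZ// -meanD//; last exact: itgZ.
rewrite -meanD//; last by apply: itgD => //; exact: itgZ.
by congr mean; apply/funext => x; ring.
Qed.

Lemma mean_CauchySchwarz f g : trigpoly f -> trigpoly g ->
  mean (fun x => f x * g x) ^+ 2 <= mean (fun x => f x ^+ 2) * mean (fun x => g x ^+ 2).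
Proof.
move=> tf tg; apply: sqr_le_of_quadratic => [|t]; first exact: mean_sqr_ge0.
have i2 := tp_itg (tpX 2 tg); have i3 := tp_itg (tpM tf tg).
have := mean_sqr_ge0 (tpD tf (tpN (tpZ t tg))).
rewrite mean_sqrB//; last exact: tpZ.
rewrite (_ : mean (fun x => f x * _) = t * mean (fun x => f x * g x)).
  rewrite (_ : mean (fun x => (t * _) ^+ 2) = t ^+ 2 * mean (fun x => g x ^+ 2)).
    by rewrite mulrA.
  by rewrite -meanZ//; congr mean; apply/funext => x; ring.
by rewrite -meanZ//; congr mean; apply/funext => x; ring.
Qed.

(** Holds for arbitrary functions, since it will be applied to absolute values, which are not
    trigonometric polynomials. *)
Lemma avg_CauchySchwarz M f g :
  avg M (fun x => f x * g x) ^+ 2 <= avg M (fun x => f x ^+ 2) * avg M (fun x => g x ^+ 2).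
Proof.
have avg_ge0 (h : R * R -> R) : 0 <= avg M (fun x => h x ^+ 2).
  rewrite mulr_ge0 ?invr_ge0 ?exprn_ge0//.
  by do 2 (apply: sumr_ge0 => ? _); rewrite sqr_ge0.
apply: sqr_le_of_quadratic => [|t]; first exact: avg_ge0.
have : 0 <= avg M (fun x => (f x - t * g x) ^+ 2) by exact: avg_ge0.
rewrite (_ : (fun _ => _) = fun x => f x ^+ 2 + ((- (2 * t)) * (f x * g x) + t ^+ 2 * g x ^+ 2)).
  by rewrite !avgD !avgZ addrA mulNr.
by apply/funext => x; ring.
Qed.

Lemma mean_sqr s f : spanned s f -> itg f ->
  mean (fun x => f x ^+ 2) = \sum_(k <- s) (cos_coef f k ^+ 2 + sin_coef f k ^+ 2).
Proof.
move=> sf itf; under eq_fun do rewrite expr2.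
by rewrite (parseval sf itf); apply: eq_bigr => k _; rewrite !expr2.
Qed.

(** A translation rotates each pair of coefficients by the angle [kdot k a]. *)
Lemma coef_shift g (a : R * R) k : trigpoly g ->
  cos_coef (fun x => g (x + a)) k = cos (kdot k a) * cos_coef g k + sin (kdot k a) * sin_coef g k /\
  sin_coef (fun x => g (x + a)) k = cos (kdot k a) * sin_coef g k - sin (kdot k a) * cos_coef g k.
Proof.
move: g; apply: tp_ind => [|b c l f tf [IH1 IH2]].
  have z0 h : mean (fun x => (0 : R) * h x) = 0.
    by under eq_fun do rewrite mul0r; rewrite mean_cst.
  by rewrite /cos_coef /sin_coef !z0 !mulr0 addr0 subr0.
have ts := tp_itg (tp_shift a tf); have itf := tp_itg tf.
have E : (fun x => b * cos (kdot l (x + a) + c)) = fun x => b * cos (kdot l x + (c + kdot l a)).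
  by apply/funext => x; rewrite kdotDr; congr (_ * cos _); ring.
have i1 := itg_cos l c; have i2 := itg_cos l (c + kdot l a).
rewrite !fcD ?fsD//; do ?exact: itgZ; last first.
- by rewrite E; exact: itgZ.
- by rewrite E; exact: itgZ.
rewrite IH1 IH2 E !fcZ ?fsZ// !fc_cos !fs_cos cosD sinD.
have cx : (l == - k)%:R * cos (kdot l a) = (l == - k)%:R * cos (kdot k a) :> R.
  by case: eqP => [->|]; rewrite ?mul0r// kdotN cosN.
have sx : (l == - k)%:R * sin (kdot l a) = - ((l == - k)%:R * sin (kdot k a)) :> R.
  by case: eqP => [->|]; rewrite ?mul0r ?oppr0// kdotN sinN mulrN.
have cy : (l == k)%:R * cos (kdot l a) = (l == k)%:R * cos (kdot k a) :> R.
  by case: eqP => [->|]; rewrite ?mul0r.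
have sy : (l == k)%:R * sin (kdot l a) = (l == k)%:R * sin (kdot k a) :> R.
  by case: eqP => [->|]; rewrite ?mul0r.
split.
- transitivity (b * 2^-1 * (cos c * ((l == - k)%:R * cos (kdot l a) + (l == k)%:R * cos (kdot l a))
    - sin c * ((l == - k)%:R * sin (kdot l a) + (l == k)%:R * sin (kdot l a))) +
    (cos (kdot k a) * cos_coef f k + sin (kdot k a) * sin_coef f k)); first by ring.
  by rewrite cx cy sx sy; ring.
- transitivity (b * 2^-1 * (sin c * ((l == - k)%:R * cos (kdot l a) - (l == k)%:R * cos (kdot l a))
    + cos c * ((l == - k)%:R * sin (kdot l a) - (l == k)%:R * sin (kdot l a))) +
    (cos (kdot k a) * sin_coef f k - sin (kdot k a) * cos_coef f k)); first by ring.
  by rewrite cx cy sx sy; ring.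
Qed.
End parseval_estimates.

(** * Ladyzhenskaya's inequality *)

Section dirichlet_bounds.
Variable R : realType.
Implicit Types (f g h : R * R -> R) (k l : int * int) (s : seq (int * int)).

Lemma tpB f g : trigpoly f -> trigpoly g -> trigpoly (fun x => f x - g x).
Proof. by move=> tf tg; apply: tpD => //; exact: tpN. Qed.

Lemma common_modes f g : trigpoly f -> trigpoly g -> exists N, spanned (modes N) f /\ spanned (modes N) g.
Proof.
move=> /tp_spanned[N1 s1] /tp_spanned[N2 s2].
by exists (maxn N1 N2); split; [apply: s1|apply: s2]; rewrite leq_max leqnn ?orbT.
Qed.

(** By Parseval each mode of the difference carries the factor $|e^{ik\cdot a}-1|^2\le(k\cdot a)^2$.
    The hypothesis on coefficients holds when [a] has length [e] along an axis and [g'] is the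
    partial derivative in that direction. *)
Lemma mean_shift_diff g g' (a : R * R) (e : R) : trigpoly g -> trigpoly g' ->
  (forall k, (kdot k a) ^+ 2 * (cos_coef g k ^+ 2 + sin_coef g k ^+ 2) = e ^+ 2 * (cos_coef g' k ^+ 2 + sin_coef g' k ^+ 2)) ->
  mean (fun x => (g (x + a) - g x) ^+ 2) <= e ^+ 2 * mean (fun x => g' x ^+ 2).
Proof.
move=> tg tg' H; have ta := tp_shift a tg; have td := tpB ta tg.
have [N [sd s']] := common_modes td tg'.
rewrite (mean_sqr sd (tp_itg td)) (mean_sqr s' (tp_itg tg')) mulr_sumr.
apply: ler_sum => k _; rewrite -H.
have [c1 c2] := coef_shift a k tg.
have -> : cos_coef (fun x => g (x + a) - g x) k = cos (kdot k a) * cos_coef g k + sin (kdot k a) * sin_coef g k - cos_coef g k.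
  have it1 := tp_itg ta; have it2 := tp_itg (tpZ (-1) tg).
  under eq_fun do rewrite -mulN1r; rewrite fcD// fcZ; last exact: tp_itg.
  by rewrite c1 mulN1r.
have -> : sin_coef (fun x => g (x + a) - g x) k = cos (kdot k a) * sin_coef g k - sin (kdot k a) * cos_coef g k - sin_coef g k.
  have it1 := tp_itg ta; have it2 := tp_itg (tpZ (-1) tg).
  under eq_fun do rewrite -mulN1r; rewrite fsD// fsZ; last exact: tp_itg.
  by rewrite c2 mulN1r.
rewrite (_ : _ + _ = ((cos (kdot k a) - 1) ^+ 2 + sin (kdot k a) ^+ 2) * (cos_coef g k ^+ 2 + sin_coef g k ^+ 2)).
  by rewrite ler_wpM2r ?addr_ge0 ?sqr_ge0// chord_le.
by ring.
Qed.

Lemma mean_shift_dx1 g (e : R) : trigpoly g ->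
  mean (fun x => (g (x + (e, 0)) - g x) ^+ 2) <= e ^+ 2 * mean (fun x => dx1 g x ^+ 2).
Proof.
move=> tg; have [t1 c1] := tp_dx1 tg; apply: mean_shift_diff => // k.
by have [-> ->] := c1 k; rewrite /kdot /=; ring.
Qed.

Lemma mean_shift_dx2 g (e : R) : trigpoly g ->
  mean (fun x => (g (x + (0, e)) - g x) ^+ 2) <= e ^+ 2 * mean (fun x => dx2 g x ^+ 2).
Proof.
move=> tg; have [t1 c1] := tp_dx2 tg; apply: mean_shift_diff => // k.
by have [-> ->] := c1 k; rewrite /kdot /=; ring.
Qed.

Lemma mean_dxE s g : spanned s (dx1 g) -> spanned s (dx2 g) -> trigpoly g ->
  mean (fun x => dx1 g x ^+ 2) + mean (fun x => dx2 g x ^+ 2) =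
  \sum_(k <- s) knorm2 R k * (cos_coef g k ^+ 2 + sin_coef g k ^+ 2).
Proof.
move=> s1 s2 tg; have [t1 c1] := tp_dx1 tg; have [t2 c2] := tp_dx2 tg.
rewrite (mean_sqr s1 (tp_itg t1)) (mean_sqr s2 (tp_itg t2)) -big_split.
apply: eq_bigr => k _ /=; have [-> ->] := c1 k; have [-> ->] := c2 k.
by rewrite /knorm2 rmorphD !rmorphXn /=; ring.
Qed.

Lemma telescope_le (phi : nat -> R) (M i j : nat) : (i < M)%N -> (j < M)%N ->
  phi j <= phi i + \sum_(m < M) `|phi m.+1 - phi m|.
Proof.
move=> iM jM; rewrite -lerBlDl.
rewrite -(big_mkord xpredT (fun m => `|phi m.+1 - phi m|)).
have H a b : (a <= b)%N -> (b < M)%N ->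
    `|phi b - phi a| <= \sum_(0 <= m < M) `|phi m.+1 - phi m|.
  move=> ab bM; rewrite -(telescope_sumr phi ab).
  rewrite (le_trans (ler_norm_sum _ _ _))//.
  rewrite [leRHS](@big_cat_nat _ _ _ a)//=; last by lia.
  rewrite [X in _ + X](@big_cat_nat _ _ _ b)//=; last by lia.
  by rewrite addrCA lerDl addr_ge0 ?sumr_ge0.
have [ij|/ltnW ji] := leqP i j; first by rewrite (le_trans (ler_norm _))// H.
by rewrite (le_trans (ler_norm _))// distrC H.
Qed.

(* A point value is bounded by the mean over a line plus the total variation along it. *)
Lemma line_bound (phi : nat -> R) (M j : nat) : (j < M)%N ->
  phi j <= M%:R^-1 * (\sum_(i < M) phi i) + \sum_(m < M) `|phi m.+1 - phi m|.
Proof.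
move=> jM; have M0 : 0 < M%:R :> R by rewrite ltr0n; lia.
rewrite -(ler_pM2l M0) mulrDr mulrA divff ?gt_eqF// mul1r.
rewrite -{1}[M]card_ord -sumr_const mulr_suml.
rewrite -[M in M%:R * \sum_(_ < _) _]card_ord mulr_natl -sumr_const -big_split.
by apply: ler_sum => i _; rewrite mul1r telescope_le.
Qed.

(** By [line_bound], [G i j] is at most [al j], free of [i], and at most [be i], free of [j]. Hence
    [G i j ^+ 2 <= be i * al j], and the double sum of the right side factors. *)
Lemma grid_ladyzhenskaya (G : nat -> nat -> R) (M : nat) : (forall i j, 0 <= G i j) ->
  \sum_(i < M) \sum_(j < M) G i j ^+ 2 <=
  (M%:R^-1 * (\sum_(i < M) \sum_(j < M) G i j) +
    \sum_(i < M) \sum_(j < M) `|G i.+1 j - G i j|) *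
  (M%:R^-1 * (\sum_(i < M) \sum_(j < M) G i j) +
    \sum_(i < M) \sum_(j < M) `|G i j.+1 - G i j|).
Proof.
move=> G0.
pose al (j : nat) := M%:R^-1 * (\sum_(i < M) G i j) + \sum_(m < M) `|G m.+1 j - G m j|.
pose be (i : nat) := M%:R^-1 * (\sum_(j < M) G i j) + \sum_(m < M) `|G i m.+1 - G i m|.
have -> : M%:R^-1 * (\sum_(i < M) \sum_(j < M) G i j) +
    \sum_(i < M) \sum_(j < M) `|G i.+1 j - G i j| = \sum_(j < M) al j.
  by rewrite big_split /= -mulr_sumr; congr (_ * _ + _); exact: exchange_big.
have -> : M%:R^-1 * (\sum_(i < M) \sum_(j < M) G i j) +
    \sum_(i < M) \sum_(j < M) `|G i j.+1 - G i j| = \sum_(i < M) be i.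
  by rewrite big_split /= -mulr_sumr.
rewrite mulrC mulr_suml; apply: ler_sum => i _; rewrite mulr_sumr; apply: ler_sum => j _.
rewrite expr2; apply: ler_pM => //.
- exact: (line_bound (G i) (ltn_ord j)).
- exact: (line_bound (fun i => G i j) (ltn_ord i)).
Qed.

Lemma fc0 g : cos_coef g 0 = mean g.
Proof.
by rewrite /cos_coef; congr mean; apply/funext => x; rewrite /kdot !mul0r addr0 cos0 mulr1.
Qed.

Lemma mean_shift g (a : R * R) : trigpoly g -> mean (fun x => g (x + a)) = mean g.
Proof.
move=> tg; have [H _] := coef_shift a 0 tg.
by rewrite -fc0 H fs0 mulr0 addr0 fc0 /kdot !mul0r addr0 cos0 mul1r.
Qed.

Lemma knorm2_ge1 k : k != 0 -> 1 <= knorm2 R k.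
Proof.
move=> k0; rewrite /knorm2 -[leLHS]/(1%:~R) ler_int -gtz0_ge1 lt0r.
rewrite addr_ge0 ?sqr_ge0// andbT paddr_eq0 ?sqr_ge0// !sqrf_eq0.
by apply: contra k0; case: (k) => a b /= /andP[/eqP -> /eqP ->].
Qed.

(** Every nonzero integer frequency has squared length at least 1, and the zero mode is absent. *)
Lemma poincare g : trigpoly g -> mean g = 0 ->
  mean (fun x => g x ^+ 2) <= mean (fun x => dx1 g x ^+ 2) + mean (fun x => dx2 g x ^+ 2).
Proof.
move=> tg g0; have [t1 _] := tp_dx1 tg; have [t2 _] := tp_dx2 tg.
have [N1 s1] := tp_spanned t1; have [N2 s2] := tp_spanned t2; have [N3 s3] := tp_spanned tg.
pose N := maxn N1 (maxn N2 N3).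
rewrite (@mean_dxE (modes N)) ?(@mean_sqr _ (modes N))//.
- apply: ler_sum => k _; have [->|k0] := eqVneq k 0.
    by rewrite fc0 fs0 g0 expr0n /= addr0 mulr0.
  by rewrite ler_peMl ?addr_ge0 ?sqr_ge0// knorm2_ge1.
- by apply: s3; lia.
- exact: tp_itg.
- by apply: s1; lia.
- by apply: s2; lia.
Qed.

(** Factor the difference of squares and apply Cauchy-Schwarz on the grid. Exact quadrature turns
    the averages of squares back into means: the difference contributes $O(M^{-2})D$, which cancels
    the prefactor, and the sum at most four times the mean of [g ^+ 2]. *)
Lemma variation_sqr_le (M : nat) g (a : R * R) (D : R) : trigpoly g -> (0 < M)%N ->
  (forall a b, avg M (fun x => g (x + a) * g (x + b)) = mean (fun x => g (x + a) * g (x + b))) ->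
  mean (fun x => (g (x + a) - g x) ^+ 2) <= (2 * pi / M%:R) ^+ 2 * D ->
  (M%:R * avg M (fun x => `|g (x + a) ^+ 2 - g x ^+ 2|)) ^+ 2 <=
    256 * (mean (fun x => g x ^+ 2) * D).
Proof.
move=> tg M0 quad diff; have M0' : M%:R != 0 :> R by rewrite pnatr_eq0 -lt0n.
have ta := tp_shift a tg.
have q00 : avg M (fun x => g x ^+ 2) = mean (fun x => g x ^+ 2).
  have := quad 0 0; by under eq_fun do rewrite !addr0 -expr2.
have qaa : avg M (fun x => g (x + a) ^+ 2) = mean (fun x => g x ^+ 2).
  rewrite -(mean_shift a (tpX 2 tg)); have := quad a a.
  by under eq_fun do rewrite -expr2.
have qa0 : avg M (fun x => g (x + a) * g x) = mean (fun x => g (x + a) * g x).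
  have := quad a 0; by under eq_fun do rewrite addr0.
have dE : avg M (fun x => (g (x + a) - g x) ^+ 2) = mean (fun x => (g (x + a) - g x) ^+ 2).
  rewrite mean_sqrB// (mean_shift a (tpX 2 tg)) -qa0 -[X in X - _]qaa -[X in _ + X]q00 -mulNr -avgZ -!avgD.
  by congr (avg M _); apply/funext => x; ring.
have sE : avg M (fun x => (g (x + a) + g x) ^+ 2) <= 4 * mean (fun x => g x ^+ 2).
  rewrite (_ : 4 * _ = 2 * avg M (fun x => g (x + a) ^+ 2) + 2 * avg M (fun x => g x ^+ 2)).
    rewrite -!avgZ -avgD; apply: avg_le => x.
    by have := sqr_ge0 (g (x + a) - g x); nra.
  by rewrite q00 qaa; ring.
have := avg_CauchySchwarz M (fun x => `|g (x + a) - g x|) (fun x => `|g (x + a) + g x|).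
under eq_fun do rewrite -normrM -subr_sqr.
under [X in _ <= avg _ X * _]eq_fun do rewrite real_normK ?num_real//.
under [X in _ <= _ * avg _ X]eq_fun do rewrite real_normK ?num_real//.
rewrite dE; set V := avg _ _ => VCS.
have m0 := mean_sqr_ge0 tg; have d0 := mean_sqr_ge0 (tpB ta tg).
have V2 : V ^+ 2 <= (2 * pi / M%:R) ^+ 2 * D * (4 * mean (fun x => g x ^+ 2)).
  apply: (le_trans VCS); apply: ler_pM => //.
  rewrite mulr_ge0 ?invr_ge0 ?exprn_ge0//.
  by do 2 (apply: sumr_ge0 => ? _); rewrite sqr_ge0.
have D0 : 0 <= D.
  have : 0 < (2 * pi / M%:R) ^+ 2 :> R.
    by rewrite exprn_gt0// divr_gt0 ?mulr_gt0 ?pi_gt0// ltr0n.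
  by move=> p; rewrite -(pmulr_rge0 _ p) (le_trans d0).
rewrite exprMn; apply: (@le_trans _ _ (M%:R ^+ 2 * ((2 * pi / M%:R) ^+ 2 * D * (4 * mean (fun x => g x ^+ 2))))).
  by rewrite ler_wpM2l ?sqr_ge0.
rewrite (_ : _ * _ = 16 * pi ^+ 2 * (mean (fun x => g x ^+ 2) * D)); last by field.
apply: ler_wpM2r; first by rewrite mulr_ge0.
(* $16\pi^2\le256$ because $\pi<4$. *)
have p2 := @pihalf_lt2 R; have p0 := @pi_gt0 R; nra.
Qed.

Lemma ladyzhenskaya g : trigpoly g -> mean g = 0 ->
  mean (fun x => g x ^+ 4) <= 258 * (mean (fun x => g x ^+ 2) *
    (mean (fun x => dx1 g x ^+ 2) + mean (fun x => dx2 g x ^+ 2))).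
Proof.
move=> tg g0.
have [M1 q1] := quadrature tg tg; have [M2 q2] := quadrature (tpX 2 tg) (tpX 2 tg).
pose M := (maxn M1 (maxn M2 1))%N.
have {}q1 := q1 M ltac:(by rewrite /M; lia); have {}q2 := q2 M ltac:(by rewrite /M; lia).
have M0 : (0 < M)%N by rewrite /M; lia.
have M0' : M%:R != 0 :> R by rewrite pnatr_eq0 -lt0n.
have := poincare tg g0.
have := variation_sqr_le tg M0 q1 (mean_shift_dx1 (2 * pi / M%:R) tg).
have := variation_sqr_le tg M0 q1 (mean_shift_dx2 (2 * pi / M%:R) tg).
set V2 := M%:R * _; set V1 := M%:R * _.
pose pt (i j : nat) : R * R := (i%:R * (2 * pi / M%:R), j%:R * (2 * pi / M%:R)).
have := @grid_ladyzhenskaya (fun i j => g (pt i j) ^+ 2) M (fun i j => sqr_ge0 _).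
have avgE f : \sum_(i < M) \sum_(j < M) f (pt i j) = M%:R ^+ 2 * avg M f.
  by rewrite /avg mulrA divff ?mul1r// expf_neq0.
have pt1 i j : pt i.+1 j = pt i j + (2 * pi / M%:R, 0).
  by apply: injective_projections; rewrite /= ?addr0// -natr1 mulrDl mul1r.
have pt2 i j : pt i j.+1 = pt i j + (0, 2 * pi / M%:R).
  by apply: injective_projections; rewrite /= ?addr0// -natr1 mulrDl mul1r.
under [X in X <= _]eq_bigr do under eq_bigr do rewrite -exprM.
under [X in _ <= (_ + X) * _]eq_bigr do under eq_bigr do rewrite pt1.
under [X in _ <= _ * (_ + X)]eq_bigr do under eq_bigr do rewrite pt2.
rewrite (avgE (fun x => g x ^+ 4)) (avgE (fun x => g x ^+ 2)).
rewrite (avgE (fun x => `|g (x + (2 * pi / M%:R, 0)) ^+ 2 - g x ^+ 2|)).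
rewrite (avgE (fun x => `|g (x + (0, 2 * pi / M%:R)) ^+ 2 - g x ^+ 2|)).
have -> : avg M (fun x => g x ^+ 4) = mean (fun x => g x ^+ 4).
  have E x : (g (x + 0) ^+ 2 * g (x + 0) ^+ 2) = g x ^+ 4 by rewrite addr0 -exprD.
  by have := q2 0 0; under eq_fun do rewrite E.
have -> : avg M (fun x => g x ^+ 2) = mean (fun x => g x ^+ 2).
  have E x : (g (x + 0) * g (x + 0)) = g x ^+ 2 by rewrite addr0 -expr2.
  by have := q1 0 0; under eq_fun do rewrite E.
set m := mean (fun x => g x ^+ 2); set m4 := mean _.
(* Each factor of the grid inequality is [M] times [m + V1] or [m + V2], so the powers of [M] cancel
   and a bound free of [M] remains. *)
rewrite [X in _ <= X](_ : _ = M%:R ^+ 2 * ((m + V1) * (m + V2))); last by rewrite /V1 /V2; field.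
rewrite ler_pM2l ?exprn_gt0 ?ltr0n// => H h2 h1 h3.
have m0 : 0 <= m := mean_sqr_ge0 tg.
apply: (le_trans H); move: V1 V2 m (mean _) (mean _) m0 h1 h2 h3 {H} => V1 V2 m D1 D2.
move=> m0 h1 h2 h3; have := ler_wpM2l m0 h3.
(* $(m+V_1)(m+V_2)\le 2m^2+V_1^2+V_2^2$. The Poincaré inequality bounds $2m^2$ by $2m(D_1+D_2)$,
   whence $258=2+256$. *)
by have := sqr_ge0 (V1 - V2); have := sqr_ge0 (m - V1); have := sqr_ge0 (m - V2); nra.
Qed.
End dirichlet_bounds.

(** * One step of the scheme *)

Section energy_step.
Variable R : realType.
Implicit Types (f g h u v : R * R -> R) (k l : int * int) (s : seq (int * int)).

Definition band_limited N g := trigpoly g /\ spanned (modes N) g.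

Definition dirichlet g := mean (fun x => dx1 g x ^+ 2) + mean (fun x => dx2 g x ^+ 2).

Definition mean_energy (nu : R) g := nu / 2 * dirichlet g + mean (fun x => Fpot (g x)).

Lemma tp_fnl g : trigpoly g -> trigpoly (fun x => fnl (g x)).
Proof. by move=> tg; apply: tpB => //; exact: tpX. Qed.

Lemma tp_Fpot g : trigpoly g -> trigpoly (fun x => Fpot (g x)).
Proof.
move=> tg; rewrite /Fpot; under eq_fun do rewrite mulrC.
by apply: tpZ; apply: tpX; apply: tpB; [exact: tpX|exact: tp_cst].
Qed.

Lemma energyE (nu : R) g : trigpoly g -> energy nu g = 4 * pi ^+ 2 * mean_energy nu g.
Proof.
move=> tg; have [/(tpX 2)/tp_itg i1 _] := tp_dx1 tg; have [/(tpX 2)/tp_itg i2 _] := tp_dx2 tg.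
rewrite /energy /energy_with integ2E meanD.
- by rewrite meanZ ?meanD//; exact: itgD.
- by apply: itgZ; exact: itgD.
- by apply: tp_itg; exact: tp_Fpot.
Qed.

Lemma dirichlet_ge0 g : trigpoly g -> 0 <= dirichlet g.
Proof.
by move=> tg; apply: addr_ge0; apply: mean_sqr_ge0; [case: (tp_dx1 tg)|case: (tp_dx2 tg)].
Qed.

(** Such a [g] is its own image under the multiplier with symbol 1. *)
Lemma coef_out s g k : uniq s -> symm s -> itg g -> spanned s g -> k \notin s ->
  cos_coef g k = 0 /\ sin_coef g k = 0.
Proof.
move=> us ss ig sg ks; have gE : g = mult s (fun=> 1) g.
  by apply/funext => x; rewrite sg; apply: eq_bigr => l _; rewrite mul1r.
have [] := @coef_mult R s (fun=> 1) g k us ss (fun _ => erefl) ig.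
by rewrite -gE (negbTE ks) !mul0r.
Qed.

Lemma sum_restrict s s' (F : int * int -> R) : uniq s -> uniq s' -> {subset s <= s'} ->
  (forall k, k \notin s -> F k = 0) -> \sum_(k <- s') F k = \sum_(k <- s) F k.
Proof.
move=> us us' ss F0; rewrite (bigID (mem s)) /= [X in _ + X]big1 => [|k /F0//].
rewrite addr0 -big_filter; apply: perm_big; apply: uniq_perm => //.
  by rewrite filter_uniq.
by move=> k; rewrite mem_filter andb_idr// => /ss.
Qed.

Lemma spanned_restrict s s' g : uniq s -> uniq s' -> {subset s <= s'} ->
  (forall k, k \notin s -> cos_coef g k = 0 /\ sin_coef g k = 0) -> spanned s' g -> spanned s g.
Proof.
move=> us us' ss g0 sg x; rewrite sg (sum_restrict us)// => k /g0[-> ->].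
by rewrite !mul0r addr0.
Qed.

Lemma XN_dx N g : band_limited N g -> band_limited N (dx1 g) /\ band_limited N (dx2 g).
Proof.
move=> [tg sg]; have [t1 c1] := tp_dx1 tg; have [t2 c2] := tp_dx2 tg.
have out k : k \notin modes N -> cos_coef g k = 0 /\ sin_coef g k = 0.
  exact: (coef_out (uniq_modes _) (@symm_modes _) (tp_itg tg) sg).
split; split=> //.
- have [M sM] := tp_spanned t1.
  apply: (spanned_restrict (uniq_modes _) (uniq_modes (maxn M N)) _ _ (sM _ _)).
  + by apply: modes_le; lia.
  + by move=> k /out[e1 e2]; have [-> ->] := c1 k; rewrite e1 e2 !mulr0.
  + by lia.
- have [M sM] := tp_spanned t2.
  apply: (spanned_restrict (uniq_modes _) (uniq_modes (maxn M N)) _ _ (sM _ _)).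
  + by apply: modes_le; lia.
  + by move=> k /out[e1 e2]; have [-> ->] := c2 k; rewrite e1 e2 !mulr0.
  + by lia.
Qed.

Lemma dirichletE N g : band_limited N g ->
  dirichlet g = \sum_(k <- modes N) knorm2 R k * (cos_coef g k ^+ 2 + sin_coef g k ^+ 2).
Proof. by move=> xg; have [[_ s1] [_ s2]] := XN_dx xg; rewrite /dirichlet (mean_dxE s1 s2 xg.1). Qed.

Lemma knorm2_ge0 k : 0 <= knorm2 R k.
Proof. by rewrite /knorm2 ler0z addr_ge0 ?sqr_ge0. Qed.

Lemma dirichlet_le N g : band_limited N g -> dirichlet g <= N%:R ^+ 2 * mean (fun x => g x ^+ 2).
Proof.
move=> xg; rewrite (dirichletE xg) (mean_sqr xg.2 (tp_itg xg.1)) mulr_sumr.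
rewrite big_seq [leRHS]big_seq; apply: ler_sum => k; rewrite mem_modes => kN.
rewrite ler_wpM2r ?addr_ge0 ?sqr_ge0// /knorm2.
by rewrite (_ : N%:R ^+ 2 = (N%:Z ^+ 2)%:~R) ?ler_int// rmorphXn.
Qed.

Lemma XNB N f g : band_limited N f -> band_limited N g -> band_limited N (fun x => f x - g x).
Proof.
move=> [tf sf] [tg sg]; split; first exact: tpB.
under eq_fun do rewrite -mulN1r.
by apply: spannedD => //; [exact: tp_itg|apply: itgZ; exact: tp_itg|apply: spannedZ => //; exact: tp_itg].
Qed.

Lemma quartic_le_Fpot (t : R) : t ^+ 4 <= 8 * Fpot t + 2.
Proof. by rewrite /Fpot; have := sqr_ge0 (t ^+ 2 - 2); lra. Qed.

Lemma sqr_le_quartic (t : R) : t ^+ 2 <= 2^-1 * t ^+ 4 + 2^-1.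
Proof. by have := sqr_ge0 (t ^+ 2 - 1); lra. Qed.

(** Here [X], [Y] and [S] are [nu] times the Dirichlet integrals of [u] and [d] and their cross
    term, [W] is [A] times the mean of [d ^+ 2], and [q] is the mean of $u^2d^2$. With $Z=W+Y$ the
    energy changes by at most $-Z+Y/2+2q+\frac34\,$[md4], where $2q\le Z/8$ and [md4] is about
    $Z/93$ at most. *)
Lemma step_arithmetic (X Y W S t q mu2 mu4 md4 mF mFv mfd B : R) :
  0 <= X -> 0 <= Y -> 0 <= W -> 0 <= q -> 0 <= mF -> 0 <= md4 ->
  - S <= 2 * X + 8^-1 * Y ->
  - mfd <= t + W / 8 + 2^-1 * mu4 + 2^-1 * q ->
  mFv <= mF + mfd + 2 * q + 3 / 4 * md4 ->
  q ^+ 2 <= mu4 * md4 -> t <= 2 * mu2 -> mu2 <= 2^-1 * mu4 + 2^-1 ->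
  mu4 <= 8 * mF + 2 -> X / 2 + mF + 1 <= B ->
  2048 * B * md4 <= (W + Y) ^+ 2 ->
  W + Y <= - S - mfd ->
  (X + 2 * S + Y) / 2 + mFv <= X / 2 + mF.
Proof.
move=> X0 Y0 W0 q0 F0 d0 HS Hfd HF Hq Ht H2 H4 HB HZ test.
have B0 : 0 < B by lra.
have mu4B : mu4 <= 8 * B by lra.
(* $q^2\le 8B\,$[md4]$\,\le (8/2048)Z^2=(Z/16)^2$. *)
have qZ : q <= (W + Y) / 16.
  rewrite -(@ler_pXn2r _ 2)// ?nnegrE//; last by rewrite divr_ge0// addr_ge0.
  have : mu4 * md4 <= 8 * B * md4 by rewrite ler_wpM2r.
  by rewrite expr_div_n; lra.
(* The tested scheme bounds $Z$ by terms of size $B$ plus $Z/8+Z/32$, which is absorbed on the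
   left. *)
have ZB : W + Y <= 22 * B by lra.
have dZ : 2048 * md4 <= 22 * (W + Y).
  rewrite -(ler_pM2l B0).
  have : (W + Y) ^+ 2 <= (22 * B) * (W + Y).
    by rewrite expr2 ler_wpM2r// addr_ge0.
  by move: HZ; lra.
lra.
Qed.

Section step.
Variables (nu tau A : R) (N : nat) (u : R * R -> R).
Hypotheses (nu0 : 0 < nu) (tau0 : 0 < tau) (A1 : 1 <= A) (xu : band_limited N u).

Let v := scheme_step nu tau A N u.
Let d x := v x - u x.
Let fu x := fnl (u x).
Let Z := A * mean (fun x => d x ^+ 2) + nu * dirichlet d.

Let m1 k := (1 + A * tau * knorm2 R k) /
  (1 + nu * tau * knorm2 R k ^+ 2 + A * tau * knorm2 R k).
Let m2 k := - (tau * knorm2 R k) /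
  (1 + nu * tau * knorm2 R k ^+ 2 + A * tau * knorm2 R k).

Let knorm2N k : knorm2 R (- k) = knorm2 R k.
Proof. by rewrite /knorm2 /= !sqrrN. Qed.

Let m1N k : m1 (- k) = m1 k. Proof. by rewrite /m1 knorm2N. Qed.
Let m2N k : m2 (- k) = m2 k. Proof. by rewrite /m2 knorm2N. Qed.

Let vE : v = fun x => mult (modes N) m1 u x + mult (modes N) m2 fu x.
Proof.
have iu := tp_itg xu.1; have iF := tp_itg (tp_fnl xu.1).
by apply/funext => x; rewrite /v /scheme_step (fmultE _ _ iu) (fmultE _ _ iF).
Qed.

Lemma XN_step : band_limited N v.
Proof.
have iu := tp_itg xu.1; have iF := tp_itg (tp_fnl xu.1).
rewrite vE; split; first by apply: tpD; exact: tp_mult.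
apply: spannedD; [exact: tp_itg (tp_mult _ _ _)|exact: tp_itg (tp_mult _ _ _)|..].
- exact: spanned_mult (uniq_modes N) (@symm_modes N) m1N iu.
- exact: spanned_mult (uniq_modes N) (@symm_modes N) m2N iF.
Qed.

Lemma XN_increment : band_limited N d. Proof. exact: XNB XN_step xu. Qed.

Lemma coef_increment k : k \in modes N ->
  cos_coef d k = m1 k * cos_coef u k + m2 k * cos_coef fu k - cos_coef u k /\
  sin_coef d k = m1 k * sin_coef u k + m2 k * sin_coef fu k - sin_coef u k.
Proof.
move=> kN; have iu := tp_itg xu.1; have iF := tp_itg (tp_fnl xu.1).
have iv := tp_itg XN_step.1.
have [c1 s1] := coef_mult k (uniq_modes N) (@symm_modes N) m1N iu.
have [c2 s2] := coef_mult k (uniq_modes N) (@symm_modes N) m2N iF.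
have i1 := tp_itg (tp_mult (modes N) m1 u); have i2 := tp_itg (tp_mult (modes N) m2 fu).
have -> : d = fun x => v x + (-1) * u x by apply/funext => x; rewrite mulN1r.
rewrite (fcD _ iv (itgZ (-1) iu)) (fsD _ iv (itgZ (-1) iu)) (fcZ _ _ iu) (fsZ _ _ iu).
have -> : cos_coef v k = m1 k * cos_coef u k + m2 k * cos_coef fu k.
  by rewrite vE fcD// c1 c2 kN !mul1r.
have -> : sin_coef v k = m1 k * sin_coef u k + m2 k * sin_coef fu k.
  by rewrite vE fsD// s1 s2 kN !mul1r.
by rewrite !mulN1r.
Qed.

(** At frequency zero the two symbols are 1 and 0, so the scheme conserves the mean. This makes
    Ladyzhenskaya's inequality applicable to the increment. *)
Lemma mean_increment : mean d = 0.
Proof.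
rewrite -fc0; have [|-> _] := @coef_increment 0.
  by rewrite mem_modes /= expr0n /= addr0 sqr_ge0.
rewrite /m1 /m2 (_ : knorm2 R 0 = 0); last by rewrite /knorm2 /= expr0n.
by rewrite expr0n /= !mulr0 !addr0 divr1 oppr0 mul0r mul1r mul0r addr0 subrr.
Qed.

(** The test with $(-\Delta)^{-1}d$ for a single mode with $|k|^2=q$. Multiplied by $\tau q$, the
    right side minus the left is exactly $e^2$, the discarded $H^{-1}$ term $e^2/(\tau q)$; for
    $q=0$ the increment [e] is zero. *)
Lemma multiplier_testing (q a f e : R) : 0 <= q ->
  e = (1 + A * tau * q) / (1 + nu * tau * q ^+ 2 + A * tau * q) * a +
    - (tau * q) / (1 + nu * tau * q ^+ 2 + A * tau * q) * f - a ->
  (A + nu * q) * e ^+ 2 <= - (nu * (q * (a * e))) - f * e.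
Proof.
move=> q0 eE; pose den := 1 + nu * tau * q ^+ 2 + A * tau * q.
have den0 : 0 < den.
  have A0 : 0 <= A by rewrite (le_trans ler01).
  have : 0 <= nu * tau * q ^+ 2 by rewrite mulr_ge0 ?sqr_ge0// mulr_ge0// ltW.
  have : 0 <= A * tau * q by rewrite mulr_ge0// mulr_ge0// ltW.
  by rewrite /den; lra.
have eq1 : den * e = - (tau * q) * (nu * q * a + f).
  by rewrite eE -/den; have := gt_eqF den0; rewrite /den => /negbT ?; field.
have [q00|q00] := eqVneq q 0.
  have e0 : e = 0.
    by apply: (mulfI (lt0r_neq0 den0)); rewrite mulr0 eq1 q00 mulr0 oppr0 mul0r.
  by rewrite e0 expr0n /= !mulr0 oppr0 addr0.
have tq : 0 < tau * q by rewrite mulr_gt0// lt0r q00.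
rewrite -subr_ge0 -(pmulr_rge0 _ tq).
rewrite [X in 0 <= X](_ : _ = e ^+ 2); first exact: sqr_ge0.
transitivity (e * (- (tau * q) * (nu * q * a + f)) - (A + nu * q) * (tau * q) * e ^+ 2); first by ring.
by rewrite -eq1 /den; ring.
Qed.

Let crossD := \sum_(k <- modes N) knorm2 R k * (cos_coef u k * cos_coef d k + sin_coef u k * sin_coef d k).

Lemma scheme_testing : Z <= - (nu * crossD) - mean (fun x => fu x * d x).
Proof.
have [td sd] := XN_increment; have iF := tp_itg (tp_fnl xu.1).
rewrite /Z (mean_sqr sd (tp_itg td)) (dirichletE XN_increment).
under [X in _ - mean X]eq_fun do rewrite mulrC.
rewrite (parseval sd iF) /crossD !mulr_sumr -big_split -!sumrN -big_split /=.
rewrite big_seq [leRHS]big_seq; apply: ler_sum => k kN.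
have [ec es] := coef_increment kN.
have := multiplier_testing (knorm2_ge0 k) ec; have := multiplier_testing (knorm2_ge0 k) es.
move: (knorm2 R k) (cos_coef u k) (sin_coef u k) (cos_coef fu k) (sin_coef fu k) (cos_coef d k) (sin_coef d k) => q *.
lra.
Qed.

Lemma dirichlet_step : dirichlet v = dirichlet u + 2 * crossD + dirichlet d.
Proof.
rewrite (dirichletE XN_step) (dirichletE xu) (dirichletE XN_increment) /crossD.
rewrite mulr_sumr -!big_split; apply: eq_bigr => k _ /=.
have iu := tp_itg xu.1; have id' := tp_itg XN_increment.1.
have vE' : v = fun x => u x + d x by apply/funext => x; rewrite /d addrC subrK.
have -> : cos_coef v k = cos_coef u k + cos_coef d k by rewrite vE' fcD.
have -> : sin_coef v k = sin_coef u k + sin_coef d k by rewrite vE' fsD.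
by ring.
Qed.

(** Mode by mode, $2a^2+ae+e^2/8=2(a+e/4)^2$. The small weight on [dirichlet d] lets [Z] absorb
    it. *)
Lemma crossD_ge : - crossD <= 2 * dirichlet u + 8^-1 * dirichlet d.
Proof.
rewrite (dirichletE xu) (dirichletE XN_increment) /crossD !mulr_sumr -sumrN -big_split.
apply: ler_sum => k _ /=; have := knorm2_ge0 k.
rewrite -subr_ge0 => q0; rewrite -subr_ge0.
rewrite [X in 0 <= X](_ : _ = 2 * ((knorm2 R k - 0) * ((cos_coef u k + 4^-1 * cos_coef d k) ^+ 2 + (sin_coef u k + 4^-1 * sin_coef d k) ^+ 2))).
  by rewrite !mulr_ge0 ?addr_ge0 ?sqr_ge0.
by field.
Qed.

(** Conditional dissipation: all that is asked of the parameters beyond positivity and [1 <= A] is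
    that the quartic mean of the increment be small against $Z^2/B$. *)
Lemma energy_step (B : R) : mean_energy nu u + 1 <= B ->
  2048 * B * mean (fun x => d x ^+ 4) <= Z ^+ 2 ->
  mean_energy nu v <= mean_energy nu u.
Proof.
have [tu _] := xu; have [td _] := XN_increment; have [tv _] := XN_step.
move=> eB HZ.
have Du := dirichlet_ge0 tu; have Dd := dirichlet_ge0 td.
have uu := mean_sqr_ge0 tu; have dd := mean_sqr_ge0 td.
have F0 : 0 <= mean (fun x => Fpot (u x)).
  rewrite -[leLHS](mean_cst (0 : R)); apply: mean_le; first exact: itg_cst.
    by apply: tp_itg; exact: tp_Fpot.
  by move=> x; rewrite divr_ge0 ?sqr_ge0.
have u4 : mean (fun x => u x ^+ 4) <= 8 * mean (fun x => Fpot (u x)) + 2.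
  have iF := tp_itg (tp_Fpot tu).
  rewrite -meanZ// -[X in _ <= _ + X](mean_cst (2 : R)) -meanD; [|exact: itgZ|exact: itg_cst].
  apply: mean_le; [exact: tp_itg (tpX 4 tu)|by apply: itgD; [exact: itgZ|exact: itg_cst]|].
  by move=> x; exact: quartic_le_Fpot.
have u2 : mean (fun x => u x ^+ 2) <= 2^-1 * mean (fun x => u x ^+ 4) + 2^-1.
  have i4 := tp_itg (tpX 4 tu).
  rewrite -meanZ// -[X in _ <= _ + X](mean_cst (2^-1 : R)) -meanD; [|exact: itgZ|exact: itg_cst].
  apply: mean_le; [exact: tp_itg (tpX 2 tu)|by apply: itgD; [exact: itgZ|exact: itg_cst]|].
  by move=> x; exact: sqr_le_quartic.
have i22 : itg (fun x => u x ^+ 2 * d x ^+ 2) by apply: tp_itg; apply: tpM; exact: tpX.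
pose q := mean (fun x => u x ^+ 2 * d x ^+ 2).
have q0 : 0 <= q.
  rewrite -[leLHS](mean_cst (0 : R)); apply: mean_le => //; first exact: itg_cst.
  by move=> x; rewrite mulr_ge0 ?sqr_ge0.
have qCS : q ^+ 2 <= mean (fun x => u x ^+ 4) * mean (fun x => d x ^+ 4).
  have := mean_CauchySchwarz (tpX 2 tu) (tpX 2 td).
  under [X in _ <= mean X * _]eq_fun do rewrite -exprM.
  by under [X in _ <= _ * mean X]eq_fun do rewrite -exprM.
have d40 : 0 <= mean (fun x => d x ^+ 4).
  have := mean_sqr_ge0 (tpX 2 td); by under eq_fun do rewrite -exprM.
have itfd : itg (fun x => fu x * d x) by apply: tp_itg; apply: tpM => //; exact: tp_fnl.
(* Young's inequality on both terms of $-f(u)d=ud-u^3d$. The weight [A] in the first leaves $\frac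
   A8 d^2$, again absorbed by [Z]. *)
have fd : - mean (fun x => fu x * d x) <= 2 / A * mean (fun x => u x ^+ 2) +
    A / 8 * mean (fun x => d x ^+ 2) + 2^-1 * mean (fun x => u x ^+ 4) + 2^-1 * q.
  have i1 := tp_itg (tpX 2 tu); have i2 := tp_itg (tpX 2 td); have i3 := tp_itg (tpX 4 tu).
  rewrite -mulN1r -!meanZ// -!meanD; do ?[exact: itgZ]; do ?[by do ?apply: itgD; exact: itgZ].
  apply: mean_le; [exact: itgZ|by do ?apply: itgD; exact: itgZ|move=> x].
  rewrite /fu /fnl; set a := u x; set b := d x.
  have A0 : A != 0 by rewrite gt_eqF// (lt_le_trans ltr01).
  have Ap : 0 < A by rewrite (lt_le_trans ltr01).
  rewrite -subr_ge0 [X in 0 <= X](_ : _ = 2^-1 * (a ^+ 2 + a * b) ^+ 2 + 2 / A * (a - A / 4 * b) ^+ 2).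
    by apply: addr_ge0; rewrite mulr_ge0 ?sqr_ge0 ?invr_ge0// divr_ge0// ltW.
  by field.
(* Exact Taylor expansion of the quartic: the remainder is $\frac12(3u^2-1)d^2+ud^3+\frac14d^4$,
   with $ud^3\le\frac12u^2d^2+\frac12d^4$. *)
have Fv : mean (fun x => Fpot (v x)) <= mean (fun x => Fpot (u x)) +
    mean (fun x => fu x * d x) + 2 * q + 3 / 4 * mean (fun x => d x ^+ 4).
  have i1 := tp_itg (tp_Fpot tu); have i2 := tp_itg (tpX 4 td); have i3 := tp_itg (tp_Fpot tv).
  rewrite -!meanZ// -!meanD//; do ?[exact: itgZ]; do ?[by do ?apply: itgD; do ?apply: itgZ].
  apply: mean_le => //; first by do ?apply: itgD; do ?apply: itgZ.
  move=> x; have -> : v x = u x + d x by rewrite /d addrC subrK.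
  rewrite /fu /fnl /Fpot; set a := u x; set b := d x.
  rewrite -subr_ge0 [X in 0 <= X](_ : _ = 2^-1 * (a * b - b ^+ 2) ^+ 2 + 2^-1 * b ^+ 2).
    by rewrite addr_ge0// mulr_ge0 ?sqr_ge0 ?invr_ge0.
  by field.
have test := scheme_testing; have cross := crossD_ge.
have A2 : 2 / A * mean (fun x => u x ^+ 2) <= 2 * mean (fun x => u x ^+ 2).
  by rewrite ler_wpM2r// ler_piMr// invf_le1// (lt_le_trans ltr01).
rewrite /mean_energy dirichlet_step; move: eB HZ test; rewrite /mean_energy /Z.
have A0 : 0 <= A by rewrite (le_trans ler01).
move: q q0 qCS fd Fv (dirichlet u) (dirichlet d) crossD Du Dd cross => q q0 qCS fd Fv Du Dd C Du0 Dd0.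
move: fd Fv qCS A2 u2 u4 F0 uu dd d40.
move: (mean (fun x => u x ^+ 2)) (mean (fun x => d x ^+ 2)) (mean (fun x => u x ^+ 4))
  (mean (fun x => d x ^+ 4)) (mean (fun x => Fpot (u x))) (mean (fun x => Fpot (v x)))
  (mean (fun x => fu x * d x)) => mu2 md2 mu4 md4 mF mFv mfd.
move: (2 / A * mu2) => t fd Fv qCS A2 u2 u4 F0 uu dd d40 cross eB HZ test.
have /(ler_wpM2l (ltW nu0)) : - C <= 2 * Du + 8^-1 * Dd := cross.
move=> cross'.
suff : (nu * Du + 2 * (nu * C) + nu * Dd) / 2 + mFv <= nu * Du / 2 + mF by lra.
apply: (@step_arithmetic _ _ (A * md2) _ t q mu2 mu4 md4 mF mFv mfd B) => //;
  rewrite ?mulr_ge0 ?(ltW nu0)//; lra.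
Qed.

End step.
End energy_step.

(** * The initial energy *)

Section initial.
Variable R : realType.
Implicit Types (f g h u v : R * R -> R) (k l : int * int) (s : seq (int * int)).
Notation mu := ((@lebesgue_measure R) \x (@lebesgue_measure R))%E.

Lemma L2fun_itg g : L2fun g -> itg g /\ itg (fun x => g x ^+ 2).
Proof.
move=> [mg ig2]; split => //.
apply: (@itg_le _ g (fun x => g x ^+ 2 + 1)) => //.
  by apply: itgD; [exact: ig2|exact: itg_cst].
by move=> x; rewrite ler_norml; have := sqr_ge0 (g x - 1); have := sqr_ge0 (g x + 1);
  move=> *; apply/andP; split; lra.
Qed.

Lemma meas2X g n : meas2 g -> meas2 (fun x => g x ^+ n).
Proof. by move=> mg; apply: measurable_funX. Qed.

(** The bound holds only almost everywhere, so the integral is compared with that of the constant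
    [M ^+ 4] off a null set. *)
Lemma Linf_itg4 g : Linf g -> itg (fun x => g x ^+ 4).
Proof.
move=> [mg [M bM]]; have m4 := meas2X 4 mg.
apply/integrableP; split; first by apply/measurable_EFinP.
apply: (@le_lt_trans _ _ (\int[mu]_(x in @box R) (cst (M ^+ 4)%:E x))%E).
  apply: ae_ge0_le_integral => //.
  - exact: measurable_box.
  - by apply: measurableT_comp => //; apply/measurable_EFinP.
  - by move=> x _; rewrite lee_fin; have := sqr_ge0 (M ^+ 2); rewrite -exprM.
  - apply: filterS bM => x Hx bx; rewrite /= lee_fin normrX.
    by rewrite lerXn2r ?nnegrE// ?Hx// (le_trans _ (Hx bx)).
rewrite integral_cst; last exact: measurable_box.
by rewrite [X in (_ * X)%E]lam2_box -EFinM ltry.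
Qed.

Lemma PiNE N g : itg g -> PiN N g = mult (modes N) (fun=> 1) g.
Proof. exact: fmultE. Qed.

Lemma coef_PiN N g k : itg g ->
  cos_coef (PiN N g) k = (k \in modes N)%:R * cos_coef g k /\
  sin_coef (PiN N g) k = (k \in modes N)%:R * sin_coef g k.
Proof.
move=> ig; rewrite PiNE//.
have [-> ->] := @coef_mult R _ (fun=> 1) g k (uniq_modes N) (@symm_modes N) (fun=> erefl) ig.
by rewrite !mul1r.
Qed.

Lemma XN_PiN N g : itg g -> band_limited N (PiN N g).
Proof.
move=> ig; rewrite PiNE//; split; first exact: tp_mult.
exact: (@spanned_mult R _ (fun=> 1) g (uniq_modes N) (@symm_modes N) (fun=> erefl) ig).
Qed.

(** Expand $0\le\|g-\Pi_Ng\|^2$; both $\|\Pi_Ng\|^2$ and the pairing of $\Pi_Ng$ with $g$ equal the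
    sum on the left. *)
Lemma bessel N g : itg g -> itg (fun x => g x ^+ 2) ->
  \sum_(k <- modes N) (cos_coef g k ^+ 2 + sin_coef g k ^+ 2) <= mean (fun x => g x ^+ 2).
Proof.
move=> ig ig2; have [tq sq] := XN_PiN N ig; have iq := tp_itg tq.
have iqg := itgM_tp tq ig; have iq2 := tp_itg (tpX 2 tq).
have E : mean (fun x => PiN N g x ^+ 2) = \sum_(k <- modes N) (cos_coef g k ^+ 2 + sin_coef g k ^+ 2).
  rewrite (mean_sqr sq iq) big_seq [RHS]big_seq; apply: eq_bigr => k kN.
  by have [-> ->] := coef_PiN N k ig; rewrite kN !mul1r.
have E' : mean (fun x => PiN N g x * g x) = \sum_(k <- modes N) (cos_coef g k ^+ 2 + sin_coef g k ^+ 2).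
  rewrite (parseval sq ig) big_seq [RHS]big_seq; apply: eq_bigr => k kN.
  by have [-> ->] := coef_PiN N k ig; rewrite kN !mul1r !expr2.
have : 0 <= mean (fun x => g x ^+ 2 + ((- 2) * (PiN N g x * g x) + PiN N g x ^+ 2)).
  rewrite -[leLHS](mean_cst (0 : R)); apply: mean_le; first exact: itg_cst.
    by apply: itgD => //; apply: itgD => //; exact: itgZ.
  by move=> x; have := sqr_ge0 (g x - PiN N g x); lra.
rewrite meanD//; last by apply: itgD => //; exact: itgZ.
rewrite meanD//; last exact: itgZ.
by rewrite meanZ// E E'; lra.
Qed.

Lemma initial_arithmetic (g D F0 F p4 u4 w4 e r : R) : 0 <= g -> 0 <= F0 -> 0 <= r ->
  e = g / 2 + F0 -> D <= g -> F <= 4^-1 * p4 + 4^-1 -> p4 <= 16 * (u4 + w4) ->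
  u4 <= 8 * F0 + 2 -> w4 <= 258 * (g ^+ 2 * r) ->
  D / 2 + F + 1 <= 5000 * (1 + e) ^+ 2 * (1 + r).
Proof.
move=> g0 F00 r0 eE Dg Fp p4u u4F w4g.
have e0 : 0 <= e by lra.
have g2r : g ^+ 2 * r <= 4 * (e ^+ 2 * r).
  rewrite mulrA ler_wpM2r// (_ : 4 * e ^+ 2 = (2 * e) ^+ 2); last by ring.
  by rewrite lerXn2r ?nnegrE ?mulr_ge0//; lra.
have er : 0 <= e * r by rewrite mulr_ge0.
have ee : 0 <= e ^+ 2 by rewrite sqr_ge0.
have eer : 0 <= e ^+ 2 * r by rewrite mulr_ge0.
have De : D / 2 + F + 1 <= 33 * e + 10 + 1032 * (4 * (e ^+ 2 * r)) by lra.
rewrite -mulrA (_ : (1 + e) ^+ 2 * (1 + r) = 1 + 2 * e + e ^+ 2 + r + 2 * (e * r) + e ^+ 2 * r); last by ring.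
lra.
Qed.

(** The absolute value keeps the constant at least 1 for every real argument, because [betac] must
    be positive on all of [R]. *)
Definition energy_cst (e : R) : R := 5000 * (1 + `|e|) ^+ 2.

Lemma energy_cst_ge1 e : 1 <= energy_cst e.
Proof.
have : 1 <= (1 + `|e|) ^+ 2 by rewrite exprn_ege1// lerDl.
by rewrite /energy_cst; move: (_ ^+ 2) => t ?; lra.
Qed.

Lemma energy_cst_le (e e' : R) : `|e| <= `|e'| -> energy_cst e <= energy_cst e'.
Proof.
move=> ee'; apply: ler_wpM2l; first exact: ler0n.
by apply: lerXn2r; rewrite ?nnegrE ?addr_ge0// lerD2l.
Qed.

Section data.
Variables (nu : R) (N : nat) (u0 g1 g2 : R * R -> R).
Hypotheses (nu0 : 0 < nu) (N2 : (2 <= N)%N).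
Hypotheses (H1 : H1_with_grad u0 g1 g2) (Hinf : Linf u0).

Let iu : itg u0. Proof. by case: H1 => /L2fun_itg[]. Qed.
Let iu2 : itg (fun x => u0 x ^+ 2). Proof. by case: H1 => /L2fun_itg[]. Qed.
Let i1 : itg g1. Proof. by case: H1 => _ [/L2fun_itg[]]. Qed.
Let i12 : itg (fun x => g1 x ^+ 2). Proof. by case: H1 => _ [/L2fun_itg[]]. Qed.
Let i2 : itg g2. Proof. by case: H1 => _ [_ [/L2fun_itg[]]]. Qed.
Let i22 : itg (fun x => g2 x ^+ 2). Proof. by case: H1 => _ [_ [/L2fun_itg[]]]. Qed.
Let iu4 : itg (fun x => u0 x ^+ 4). Proof. exact: Linf_itg4. Qed.

Let G := mean (fun x => g1 x ^+ 2) + mean (fun x => g2 x ^+ 2).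
Let e0 := (4 * pi ^+ 2)^-1 * energy_with nu u0 g1 g2.

Lemma grad_coef k :
  [/\ k.1%:~R * sin_coef u0 k = cos_coef g1 k, k.1%:~R * cos_coef u0 k = - sin_coef g1 k,
      k.2%:~R * sin_coef u0 k = cos_coef g2 k & k.2%:~R * cos_coef u0 k = - sin_coef g2 k].
Proof.
have meanN f g : integ2 f = - integ2 g -> mean f = - mean g.
  by move=> e; rewrite /mean e mulrN.
case: H1 => _ [_ [_ /(_ k)[/meanN a1 /meanN a2 /meanN a3 /meanN a4]]]; split.
- rewrite /cos_coef -[RHS]opprK -a1 -meanZ; last exact: itgs.
  rewrite -mulN1r -meanZ; last by under eq_fun do rewrite mulrCA; apply: itgZ; exact: itgs.
  by congr mean; apply/funext => x; ring.
- by rewrite /sin_coef -a2 -meanZ; [congr mean; apply/funext => x; ring|exact: itgc].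
- rewrite /cos_coef -[RHS]opprK -a3 -meanZ; last exact: itgs.
  rewrite -mulN1r -meanZ; last by under eq_fun do rewrite mulrCA; apply: itgZ; exact: itgs.
  by congr mean; apply/funext => x; ring.
- by rewrite /sin_coef -a4 -meanZ; [congr mean; apply/funext => x; ring|exact: itgc].
Qed.

(** The weak gradient identities express the coefficients of [g1] and [g2] through those of [u0], so
    this is Bessel's inequality for both components. *)
Lemma grad_bessel M :
  \sum_(k <- modes M) knorm2 R k * (cos_coef u0 k ^+ 2 + sin_coef u0 k ^+ 2) <= G.
Proof.
apply: (le_trans _ (lerD (bessel M i1 i12) (bessel M i2 i22))).
rewrite -big_split; apply: ler_sum => k _ /=; have [<- a2 <- a4] := grad_coef k.
rewrite -(sqrrN (sin_coef g1 k)) -a2 -(sqrrN (sin_coef g2 k)) -a4.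
by rewrite /knorm2 rmorphD !rmorphXn /= -subr_ge0 [X in 0 <= X](_ : _ = 0)//; ring.
Qed.

Let p := PiN N u0.

Lemma dirichlet_PiN_le : dirichlet p <= G.
Proof.
apply: le_trans (grad_bessel N); rewrite (dirichletE (XN_PiN N iu)).
rewrite big_seq [leRHS]big_seq; apply: ler_sum => k kN.
by have [-> ->] := coef_PiN N k iu; rewrite kN !mul1r.
Qed.

Let w L x := PiN L u0 x - p x.

Lemma XN_modes_le L g : (N <= L)%N -> band_limited N g -> band_limited L g.
Proof.
move=> NL [tg sg]; split=> // x; rewrite sg; apply/esym; apply: sum_restrict.
- exact: uniq_modes.
- exact: uniq_modes.
- exact: modes_le.
- move=> k kN.
  have [-> ->] := coef_out (uniq_modes N) (@symm_modes N) (tp_itg tg) sg kN.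
  by rewrite !mul0r addr0.
Qed.

Lemma XN_tail L : (N <= L)%N -> band_limited L (w L).
Proof. by move=> NL; apply: XNB; [exact: XN_PiN|apply: XN_modes_le => //; exact: XN_PiN]. Qed.

Lemma coef_tail L k : k \in modes L ->
  cos_coef (w L) k = (k \notin modes N)%:R * cos_coef u0 k /\ sin_coef (w L) k = (k \notin modes N)%:R * sin_coef u0 k.
Proof.
move=> kL; have iL := tp_itg (XN_PiN L iu).1; have iN := tp_itg (XN_PiN N iu).1.
have -> : w L = fun x => PiN L u0 x + (-1) * PiN N u0 x.
  by apply/funext => x; rewrite mulN1r.
rewrite (fcD _ iL (itgZ (-1) iN)) (fsD _ iL (itgZ (-1) iN)) (fcZ _ _ iN) (fsZ _ _ iN).
have [-> ->] := coef_PiN L k iu; have [-> ->] := coef_PiN N k iu; rewrite kL.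
by case: (k \in modes N) => /=; split; ring.
Qed.

(** All frequencies of [w L] exceed [N], so its squared norm is at most $N^{-2}$ times its Dirichlet
    integral, itself at most [G]. Ladyzhenskaya's inequality then gives a bound uniform in [L]. *)
Lemma tail_quartic L : (N <= L)%N ->
  mean (fun x => w L x ^+ 4) <= 258 * (G ^+ 2 / N%:R ^+ 2).
Proof.
move=> NL; have xw := XN_tail NL; have [tw sw] := xw.
have N0 : 0 < N%:R ^+ 2 :> R by rewrite exprn_gt0// ltr0n (leq_trans _ N2).
have Dw : dirichlet (w L) <= G.
  apply: le_trans (grad_bessel L); rewrite (dirichletE xw).
  rewrite big_seq [leRHS]big_seq; apply: ler_sum => k kL.
  have [-> ->] := coef_tail kL; rewrite ler_wpM2l ?knorm2_ge0//.
  by case: (_ \notin _); rewrite ?mul1r// !mul0r expr0n /= addr0 addr_ge0 ?sqr_ge0.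
have ww : N%:R ^+ 2 * mean (fun x => w L x ^+ 2) <= dirichlet (w L).
  rewrite (dirichletE xw) (mean_sqr sw (tp_itg tw)) mulr_sumr.
  rewrite big_seq [leRHS]big_seq; apply: ler_sum => k kL.
  have [-> ->] := coef_tail kL; case: (boolP (k \in modes N)) => kN /=.
    by rewrite !mul0r expr0n /= addr0 !mulr0.
  rewrite ler_wpM2r ?addr_ge0 ?sqr_ge0//.
  rewrite mem_modes -ltNge in kN.
  rewrite (_ : N%:R ^+ 2 = (N%:Z ^+ 2)%:~R); last by rewrite rmorphXn.
  by rewrite /knorm2 ler_int ltW.
have w0 : mean (w L) = 0.
  have z0 M : 0 \in modes M by rewrite mem_modes /= expr0n /= addr0 sqr_ge0.
  by rewrite -fc0; have [-> _] := coef_tail (z0 L); rewrite z0 mul0r.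
apply: (le_trans (ladyzhenskaya tw w0)); rewrite ler_wpM2l// -/(dirichlet _).
rewrite mulrC expr2 -mulrA; apply: ler_pM => //.
- exact: dirichlet_ge0.
- exact: mean_sqr_ge0.
- by rewrite ler_pdivlMr// mulrC (le_trans ww).
Qed.

(** [L] is chosen so large that [p ^ 3] lies in the span of [modes L]; pairing it with [u0] or with
    [PiN L u0 = p + w L] then gives the same value, so that $\int p^4=\int p^3u_0-\int p^3w$. *)
Lemma quartic_PiN : exists2 L, (N <= L)%N &
  mean (fun x => p x ^+ 4) <= 16 * (mean (fun x => u0 x ^+ 4) + mean (fun x => w L x ^+ 4)).
Proof.
have xp := XN_PiN N iu; have [tp' sp] := xp; have t3 := tpX 3 tp'.
have [L0 sL] := tp_spanned t3; pose L := maxn L0 N.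
have NL : (N <= L)%N by rewrite /L; lia.
have {}sL := sL L ltac:(by rewrite /L; lia).
exists L => //; have [tw sw] := XN_tail NL; have [tL _] := XN_PiN L iu.
have iw := tp_itg tw; have iw4 := tp_itg (tpX 4 tw); have ip4 := tp_itg (tpX 4 tp').
have i3u := itgM_tp t3 iu; have i3w := tp_itg (tpM t3 tw).
have E1 : mean (fun x => p x ^+ 3 * u0 x) = mean (fun x => p x ^+ 3 * PiN L u0 x).
  rewrite (parseval sL iu) (parseval sL (tp_itg tL)) big_seq [RHS]big_seq.
  by apply: eq_bigr => k kL; have [-> ->] := coef_PiN L k iu; rewrite kL !mul1r.
have E2 : mean (fun x => p x ^+ 4) = mean (fun x => p x ^+ 3 * u0 x + (-1) * (p x ^+ 3 * w L x)).
  rewrite meanD//; last exact: itgZ.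
  rewrite E1 -meanD//; [|exact: tp_itg (tpM t3 tL)|exact: itgZ].
  by congr mean; apply/funext => x; rewrite /w; ring.
(* Used twice, this leaves half of the quartic mean of [p] to absorb, whence the constant
   $16=2\cdot8$. *)
have young (a b : R) : a ^+ 3 * b <= 4^-1 * a ^+ 4 + 8 * b ^+ 4.
  rewrite -subr_ge0 [X in 0 <= X](_ : _ =
    8^-1 * (a ^+ 2 - 4 * (a * b)) ^+ 2 + 8^-1 * (a ^+ 2 - 8 * b ^+ 2) ^+ 2).
    by rewrite addr_ge0// mulr_ge0 ?sqr_ge0 ?invr_ge0.
  by field.
have : mean (fun x => p x ^+ 4) <= mean (fun x => 2^-1 * p x ^+ 4 +
     (8 * u0 x ^+ 4 + 8 * w L x ^+ 4)).
  rewrite E2; apply: mean_le.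
  - by apply: itgD => //; exact: itgZ.
  - by apply: itgD; [exact: itgZ|apply: itgD; exact: itgZ].
  - move=> x; have := young (p x) (u0 x); have := young (p x) (- w L x).
    by rewrite (_ : (- w L x) ^+ 4 = w L x ^+ 4); [lra|ring].
rewrite meanD; [|exact: itgZ|by apply: itgD; exact: itgZ].
rewrite meanD; [|exact: itgZ..]; rewrite !meanZ//; lra.
Qed.

Lemma data_energyE : e0 = nu / 2 * G + mean (fun x => Fpot (u0 x)) /\
  mean (fun x => u0 x ^+ 4) <= 8 * mean (fun x => Fpot (u0 x)) + 2 /\
  0 <= mean (fun x => Fpot (u0 x)).
Proof.
have iF : itg (fun x => Fpot (u0 x)).
  rewrite (_ : (fun _ => _) = fun x => 4^-1 * u0 x ^+ 4 + ((- 2^-1) * u0 x ^+ 2 + 4^-1)).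
    by apply: itgD; [exact: itgZ|apply: itgD; [exact: itgZ|exact: itg_cst]].
  by apply/funext => x; rewrite /Fpot; field.
split.
  rewrite /e0 -/(mean _) meanD//; last by apply: itgZ; exact: itgD.
  by rewrite meanZ ?meanD//; exact: itgD.
split.
  rewrite -meanZ// -[X in _ <= _ + X](mean_cst (2 : R)) -meanD; [|exact: itgZ|exact: itg_cst].
  apply: mean_le => //; first by apply: itgD; [exact: itgZ|exact: itg_cst].
  by move=> x; exact: quartic_le_Fpot.
rewrite -[leLHS](mean_cst (0 : R)); apply: mean_le => //; first exact: itg_cst.
by move=> x; rewrite divr_ge0 ?sqr_ge0.
Qed.

Lemma initial_energy_le : 0 <= e0 /\
  mean_energy nu p + 1 <= energy_cst e0 * (1 + (nu * N%:R)^-1 ^+ 2).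
Proof.
have [e0E [u4 F0]] := data_energyE.
have [L NL pL] := quartic_PiN; have wL := tail_quartic NL; have DG := dirichlet_PiN_le.
have tp' : trigpoly p by case: (XN_PiN N iu).
have D0 := dirichlet_ge0 tp'.
have Fp : mean (fun x => Fpot (p x)) <= 4^-1 * mean (fun x => p x ^+ 4) + 4^-1.
  have i4 := tp_itg (tpX 4 tp').
  rewrite -meanZ// -[X in _ <= _ + X](mean_cst (4^-1 : R)) -meanD; [|exact: itgZ|exact: itg_cst].
  apply: mean_le; first by apply: tp_itg; exact: tp_Fpot.
    by apply: itgD; [exact: itgZ|exact: itg_cst].
  by move=> x; rewrite /Fpot; have := sqr_ge0 (p x); lra.
have nG : nu * G <= 2 * e0 by lra.
have nD : nu * dirichlet p <= nu * G by rewrite ler_wpM2l// ltW.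
have nG0 : 0 <= nu * G by apply: le_trans nD; rewrite mulr_ge0// ltW.
have e00 : 0 <= e0 by lra.
split => //.
set r := _ ^-1 ^+ 2; have r0 : 0 <= r by exact: sqr_ge0.
have NN : N%:R != 0 :> R by rewrite pnatr_eq0 -lt0n (leq_trans _ N2).
(* The energy controls only [nu * G]; trading [G] for it produces the factor $(\nu N)^{-2}$. *)
have Gr : G ^+ 2 / N%:R ^+ 2 = (nu * G) ^+ 2 * r.
  by rewrite /r; field; rewrite NN gt_eqF.
rewrite /mean_energy /energy_cst (ger0_norm e00) [_ / 2 * dirichlet p]mulrAC.
by apply: (@initial_arithmetic (nu * G) _ (mean (fun x => Fpot (u0 x))) _
  (mean (fun x => p x ^+ 4)) (mean (fun x => u0 x ^+ 4)) (mean (fun x => w L x ^+ 4)));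
  rewrite // -?Gr// e0E mulrAC.
Qed.

End data.
End initial.

(** * Size of the stabilization and conclusion *)

(** The logarithm vanishes only at [nu = 1], where the second term takes over; for $\nu<\frac12$ one
    has $|\ln\nu|\ge1-\nu\ge\frac12$. *)
Lemma sqr_ln_ge (R : realType) (nu : R) : 0 < nu -> 4^-1 <= `|ln nu| ^+ 2 + nu.
Proof.
move=> nu0; have [n2|n2] := leP 2^-1 nu; first by have := sqr_ge0 `|ln nu|; lra.
have : ln nu <= nu - 1.
  by rewrite -{1}(subrKC 1 nu) le_ln1Dx// ltrBrDl subrr.
move=> lnu; have l2 : 2^-1 <= `|ln nu| by rewrite ler0_norm; lra.
have : 2^-1 ^+ 2 <= `|ln nu| ^+ 2 by rewrite lerXn2r ?nnegrE.
lra.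
Qed.

(* The summand [1] is absorbed by AM-GM, [4 nu A m D <= (A m + nu D)^2], and the
   summand [(nu n)^-2] by [D <= n^2 m]. *)
Lemma quartic_increment_le (R : realType) (nu A n c m D : R) :
  0 < nu -> 1 <= A -> 0 < n -> 1 <= c -> 2 * c <= nu * A -> 0 <= m -> 0 <= D ->
  D <= n ^+ 2 * m ->
  c * (1 + (nu * n)^-1 ^+ 2) * (m * D) <= (A * m + nu * D) ^+ 2.
Proof.
move=> nu0 A1 n0 c1 cA m0 D0 Dn.
have A0 : 0 < A by lra.
have pos : 0 < nu * A by rewrite mulr_gt0.
have b1 : 2 * (nu * A) * (m * D) <= (A * m + nu * D) ^+ 2 / 2.
  by have := sqr_ge0 (A * m - nu * D); lra.
have mD : 0 <= m * D by rewrite mulr_ge0.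
have b2 : c * (m * D) <= (A * m + nu * D) ^+ 2 / 2.
  apply: le_trans b1; rewrite ler_wpM2r//; lra.
have b3 : c * ((nu * n)^-1 ^+ 2 * (m * D)) <= (A * m + nu * D) ^+ 2 / 2.
  have e1 : (nu * n)^-1 ^+ 2 * (m * D) <= (nu * A) ^-1 ^+ 2 * (A * m) ^+ 2.
    have -> : (nu * A)^-1 ^+ 2 * (A * m) ^+ 2 = (nu * n)^-1 ^+ 2 * (m * (n ^+ 2 * m)).
      by field; rewrite !gt_eqF.
    by rewrite ler_wpM2l ?sqr_ge0// ler_wpM2l.
  have e2 : (A * m) ^+ 2 <= (A * m + nu * D) ^+ 2.
    rewrite lerXn2r ?nnegrE ?addr_ge0 ?mulr_ge0 ?(ltW A0) ?(ltW nu0)//.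
    by rewrite lerDl mulr_ge0// ltW.
  (* $c\le\nu A/2\le(\nu A)^2/2$, since $\nu A\ge2c\ge1$. *)
  have e3 : c * (nu * A)^-1 ^+ 2 <= 2^-1.
    rewrite exprVn ler_pdivrMr ?exprn_gt0//.
    have : nu * A * 1 <= nu * A * (nu * A) by rewrite ler_wpM2l ?ltW//; lra.
    lra.
  apply: (@le_trans _ _ (c * ((nu * A)^-1 ^+ 2 * (A * m) ^+ 2))); first by rewrite ler_wpM2l//; lra.
  rewrite mulrA mulrC; apply: ler_pM => //; rewrite ?sqr_ge0//.
  by rewrite mulr_ge0 ?sqr_ge0//; lra.
have -> : c * (1 + (nu * n)^-1 ^+ 2) * (m * D) = c * (m * D) + c * ((nu * n)^-1 ^+ 2 * (m * D)) by ring.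
lra.
Qed.

(** The summand 1 gives [A >= beta >= 1]. Multiplied by [nu], the last two summands become
    $|\ln\nu|^2+\nu\ge\frac14$, so $\nu A\ge\beta/4\ge2c$. *)
Lemma stabilization_ge (R : realType) (nu A beta c l : R) : 0 < nu -> 1 <= c ->
  8 * c <= beta -> beta * (l ^+ 2 + nu^-1 * `|ln nu| ^+ 2 + 1) <= A ->
  1 <= A /\ 2 * c <= nu * A.
Proof.
move=> nu0 c1 cb hA; have b0 : 0 <= beta by lra.
have l0 := sqr_ge0 l.
have q0 : 0 <= nu^-1 * `|ln nu| ^+ 2 by rewrite mulr_ge0 ?sqr_ge0// invr_ge0 ltW.
have {}hA : beta * (nu^-1 * `|ln nu| ^+ 2 + 1) <= A.
  by apply: le_trans hA; apply: ler_wpM2l => //; lra.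
split.
  apply: le_trans hA; apply: (@le_trans _ _ (beta * 1)); first by lra.
  by apply: ler_wpM2l => //; lra.
apply: le_trans (ler_wpM2l (ltW nu0) hA).
have -> : nu * (beta * (nu^-1 * `|ln nu| ^+ 2 + 1)) = beta * (`|ln nu| ^+ 2 + nu).
  by field; rewrite gt_eqF.
apply: le_trans (ler_wpM2l b0 (sqr_ln_ge nu0)).
lra.
Qed.

Lemma normr_mean_le (R : realType) (E : R) : `|(4 * pi ^+ 2)^-1 * E| <= `|E|.
Proof.
rewrite normrM ler_piMl// normfV ger0_norm ?(ltW (four_pi2_gt0 R))//.
rewrite invf_le1 ?four_pi2_gt0//.
have : 1 <= pi ^+ 2 :> R by rewrite exprn_ege1//; have := @pi_ge2 R; lra.
lra.
Qed.

Theorem theorem1p1 (R : realType) :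
  exists betac : R -> R, (forall E0 : R, 0 < betac E0) /\
  forall (nu tau : R) (N : nat) (u0 g1 g2 : R * R -> R) (A beta : R)
         (u : nat -> R * R -> R),
    0 < nu -> 0 < tau -> (2 <= N)%N ->
    H1_with_grad u0 g1 g2 -> Linf u0 -> integ2 u0 = 0 ->
    u 0%N = PiN N u0 ->
    (forall n : nat, u n.+1 = scheme_step nu tau A N (u n)) ->
    betac (energy_with nu u0 g1 g2) <= beta ->
    beta * (linf_norm u0 ^+ 2 + nu^-1 * `|ln nu| ^+ 2 + 1) <= A ->
    forall n : nat, energy nu (u n.+1) <= energy nu (u n).
Proof.
(* The factor 2048 is that of [energy_step], 258 that of [ladyzhenskaya]; the 8 in the next witness
   is required by [stabilization_ge]. *)
pose c (e : R) : R := 2048 * (258 * energy_cst e).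
have c1 e : 1 <= c e by rewrite /c; have := energy_cst_ge1 e; lra.
exists (fun e => 8 * c e); split=> [e|]; first by have := c1 e; lra.
move=> nu tau N u0 g1 g2 A beta u nu0 tau0 N2 hu0 hinf _ uz uS hb hA.
have [A1 cA] := stabilization_ge nu0 (c1 _) hb hA.
have [_ init] := initial_energy_le nu0 N2 hu0 hinf.
(* The initial bound involves the energy divided by the area $4\pi^2\ge1$; monotonicity of
   [energy_cst] in the absolute value passes to $E_0$ itself. *)
move: (normr_mean_le (energy_with nu u0 g1 g2)) cA init.
move: (energy_with nu u0 g1 g2) => E0 /energy_cst_le EE0 cA init {hb}.
pose r : R := 1 + (nu * N%:R)^-1 ^+ 2.
have r0 : 0 <= r by rewrite addr_ge0 ?sqr_ge0.
pose B : R := energy_cst E0 * r.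
have initB : mean_energy nu (PiN N u0) + 1 <= B.
  by apply: (le_trans init); apply: ler_wpM2r.
have iu0 : itg u0 by case: hu0 => /L2fun_itg[].
have n0 : 0 < N%:R :> R by rewrite ltr0n (leq_trans _ N2).
have stepE v : band_limited N v -> mean_energy nu v + 1 <= B ->
    mean_energy nu (scheme_step nu tau A N v) <= mean_energy nu v.
  move=> xv vB; apply: (@energy_step R nu tau A N v nu0 tau0 A1 xv B vB).
  have xd := XN_increment nu tau A xv; have [td _] := xd.
  have dm := mean_increment nu tau A xv.
  have := quartic_increment_le nu0 A1 n0 (c1 _) cA
    (mean_sqr_ge0 td) (dirichlet_ge0 td) (dirichlet_le xd).
  apply: le_trans; have := ladyzhenskaya td dm; rewrite -/(dirichlet _).
  have B0 : 0 <= 2048 * B.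
    apply: mulr_ge0; first exact: ler0n.
    exact: mulr_ge0 (le_trans ler01 (energy_cst_ge1 _)) r0.
  move=> /(ler_wpM2l B0) /le_trans; apply.
  have E (e s m D : R) : 2048 * (e * s) * (258 * (m * D)) = 2048 * (258 * e) * s * (m * D).
    by ring.
  rewrite /B /c E; exact: lexx.
(* Since each step decreases the energy, the initial bound [B] is inherited and the same smallness
   condition serves at every step. *)
have H n : band_limited N (u n) /\ mean_energy nu (u n) + 1 <= B.
  elim: n => [|n [xn eB]]; first by rewrite uz; split=> //; exact: XN_PiN.
  rewrite uS; split; first exact: XN_step.
  by apply: (le_trans _ eB); rewrite lerD2r; exact: stepE.
move=> n; have [xn eB] := H n; have [xSn _] := H n.+1.
rewrite (energyE _ xn.1) (energyE _ xSn.1).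
by rewrite uS; apply: (ler_wpM2l (ltW (four_pi2_gt0 R))); exact: stepE.
Qed.
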